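(* Let $P$ be a triangulated surface in $\mathbb{R}^3$, with $A,B,A',B'$ points on the edges of $P$, such that the quadrilateral $ABA'B'$ (the closed polygon with sides $AB$, $BA'$, $A'B'$, $B'A$) lies on the surface of $P$ and splits it into two parts. If $ABA'B'$ has a rotational symmetry (a half-turn about a line swapping $A$ with $A'$ and $B$ with $B'$), then the cut and twisted surface $P^{\mathrm{I}}_{ABA'B'}$ has the same freedom to flex as $P$. Respectively, if $ABA'B'$ has a reflectional symmetry (a reflection in a plane through $A$ and $A'$ swapping $B$ with $B'$), then the cut and reflected surface $P^{\mathrm{II}}_{ABA'B'}$ has the same freedom to flex as $P$.
   Context: $P$ is a polyhedral surface with triangular faces in $\mathbb{R}^3$, possibly self-intersecting. Flexing means moving continuously, not merely by rigid motions of the whole, so that every face stays congruent to itself while dihedral angles may vary; $P$ is flexible if it admits such a motion. The sides $AB$, $BA'$, $A'B'$, $B'A$ of the quadrilateral lie on faces of $P$. Cut and twisted surface $P^{\mathrm{I}}_{ABA'B'}$: here $AB=A'B'$ and $A'B=AB'$, and there is a line $l$ such that the half-turn about $l$ swaps $A$ with $A'$ and $B$ with $B'$. Cut $P$ along the quadrilateral $ABA'B'$ into two pieces, turn one of the pieces by $180^\circ$ about $l$, and glue the two pieces back together along $ABA'B'$. Cut and reflected surface $P^{\mathrm{II}}_{ABA'B'}$: here $AB=AB'$ and $A'B=A'B'$, and there is a plane $\pi$ through $A$ and $A'$ such that reflection in $\pi$ swaps $B$ and $B'$. Cut $P$ along the quadrilateral $ABA'B'$ into two pieces, reflect one of the pieces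 in $\pi$, and glue the two boundaries back together along $ABA'B'$. ''Has the same freedom to flex as $P$'' is used informally, in the following sense: after cutting, the two pieces can flex individually in the same way as when $P$ flexed; since the side lengths of the quadrilateral are preserved, it keeps its symmetry throughout the motion, so the turned (respectively reflected) piece stays glued to the other one. In particular, the new surface is flexible if $P$ is flexible.
   Formalization: Each flex of P gives glued placements of the new surface at all times; these are claimed to form a continuous flex only if the symmetry line or plane of ABA'B' is never ambiguous (collinear corners). The converse is claimed only when no face is cut. *)

(* Defs.v *)
From HB Require Import structures.
From mathcomp Require Import all_boot all_order all_algebra.
From mathcomp Require Import all_classical all_reals all_analysis.
Set Implicit Arguments.
Unset Strict Implicit.
Unset Printing Implicit Defensive.
Import Order.TTheory GRing.Theory Num.Theory.
Import numFieldNormedType.Exports.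
Local Open Scope classical_set_scope.
Local Open Scope ring_scope.

(* Points of R^3 are row vectors.  The library norm on 'rV[R]_3 is the sup norm
   (it only provides the topology); lengths below are Euclidean. *)

Definition dot (R : realType) (x y : 'rV[R]_3) : R := \sum_(i < 3) x 0 i * y 0 i.

Definition edist (R : realType) (x y : 'rV[R]_3) : R :=
  Num.sqrt (dot (x - y) (x - y)).

Definition rigid_motion (R : realType) (g : 'rV[R]_3 -> 'rV[R]_3) : Prop :=
  exists (Q : 'M[R]_3) (c : 'rV[R]_3),
    [/\ Q *m Q^T = 1%:M, \det Q = 1 & forall x, g x = x *m Q + c].

(* For [dot u u = 1]: half-turn about the line through [c] with direction [u],
   and reflection in the plane through [c] with normal [u]. *)
Definition half_turn (R : realType) (c u x : 'rV[R]_3) : 'rV[R]_3 :=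
  c + (2 * dot (x - c) u) *: u - (x - c).

Definition reflection (R : realType) (c u x : 'rV[R]_3) : 'rV[R]_3 :=
  x - (2 * dot (x - c) u) *: u.

Definition half_turn_symmetry (R : realType) (h : 'rV[R]_3 -> 'rV[R]_3)
    (a b a' b' : 'rV[R]_3) : Prop :=
  (exists c u, dot u u = 1 /\ forall x, h x = half_turn c u x) /\
  [/\ h a = a', h a' = a, h b = b' & h b' = b].

Definition reflection_symmetry (R : realType) (h : 'rV[R]_3 -> 'rV[R]_3)
    (a b a' b' : 'rV[R]_3) : Prop :=
  (exists c u, [/\ dot u u = 1, dot (a - c) u = 0, dot (a' - c) u = 0
                 & forall x, h x = reflection c u x]) /\
  (h b = b' /\ h b' = b).

(* A polyhedral surface in R^3, possibly self-intersecting: abstract points,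
   their positions in space, and closed faces given as sets of abstract points.
   Gluing is recorded by [glued] instead of by a quotient. *)
Record polysurf (R : realType) := Polysurf {
  point : Type;
  points : set point;
  faces : set (set point);
  glued : point -> point -> Prop;
  pos : point -> 'rV[R]_3 }.

Arguments points {R} P : rename.
Arguments faces {R} P : rename.
Arguments glued {R} P : rename.
Arguments pos {R} P : rename.

Section Flexing.
Variables (R : realType) (P : polysurf R).

(* A placement of the surface in space with every face congruent to the
   original one and with the gluing respected. *)
Definition configuration (q : point P -> 'rV[R]_3) : Prop :=
  (forall F, faces P F -> forall x y, F x -> F y ->
     edist (q x) (q y) = edist (pos P x) (pos P y)) /\
  (forall x y, glued P x y -> q x = q y).

Definition motion (q : R -> point P -> 'rV[R]_3) : Prop :=
  [/\ forall x, points P x -> q 0 x = pos P x,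
      forall t, 0 <= t <= 1 -> configuration (q t)
    & forall x, points P x -> {within `[0, 1], continuous (fun t => q t x)}].

Definition nontrivial (q : R -> point P -> 'rV[R]_3) : Prop :=
  exists t, 0 <= t <= 1 /\
    ~ exists g, rigid_motion g /\ forall x, points P x -> q t x = g (pos P x).

Definition flexible : Prop := exists q, motion q /\ nontrivial q.

End Flexing.

Arguments configuration {R} P q.
Arguments motion {R} P q.
Arguments nontrivial {R} P q.

(* Abstract triangulated surfaces on the vertices 0, ..., n-1; their points are
   given by barycentric coordinates in 'rV[R]_n. *)

Definition simplex (R : realType) (n : nat) (s : {set 'I_n}) : set 'rV[R]_n :=
  [set x | [/\ forall i, 0 <= x 0 i, \sum_i x 0 i = 1
             & forall i, i \notin s -> x 0 i = 0]].

Definition body (R : realType) (n : nat) (K : {set {set 'I_n}}) : set 'rV[R]_n :=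
  [set x | exists2 f, f \in K & simplex f x].

Definition edge (n : nat) (K : {set {set 'I_n}}) (e : {set 'I_n}) : Prop :=
  #|e| = 2%N /\ exists2 f, f \in K & e \subset f.

(* A connected compact surface, with or without boundary: at most two faces meet
   along an edge, and the faces around a vertex form a single fan. *)
Definition triangulated_surface (R : realType) (n : nat)
    (K : {set {set 'I_n}}) : Prop :=
  [/\ forall f, f \in K -> #|f| = 3%N,
      forall e, edge K e -> (#|[set f in K | e \subset f]| <= 2)%N,
      forall v f g, f \in K -> g \in K -> v \in f -> v \in g ->
        connect [rel f1 f2 : {set 'I_n} | [&& f1 \in K, f2 \in K,
                   v \in f1 :&: f2 & (2 <= #|f1 :&: f2|)%N]] f g
    & connected (@body R n K)].

(* Row [i] of [p] is the position of vertex [i]; no face is degenerate. *)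
Definition realization (R : realType) (n : nat) (K : {set {set 'I_n}})
    (p : 'M[R]_(n, 3)) : Prop :=
  forall f i j k, f \in K -> i \in f -> j \in f -> k \in f ->
    i != j -> j != k -> i != k ->
    row_free (col_mx (row j p - row i p) (row k p - row i p)).

Definition tri_surface (R : realType) (n : nat) (K : {set {set 'I_n}})
    (p : 'M[R]_(n, 3)) : polysurf R :=
  {| point := 'rV[R]_n;
     points := body K;
     faces := [set F | exists2 f, f \in K & F = simplex f];
     glued := eq;
     pos := fun x => x *m p |}.

Definition on_edge (R : realType) (n : nat) (K : {set {set 'I_n}})
    (x : 'rV[R]_n) : Prop :=
  exists2 e, edge K e & simplex e x.

Definition on_common_face (R : realType) (n : nat) (K : {set {set 'I_n}})
    (x y : 'rV[R]_n) : Prop :=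
  exists2 f, f \in K & simplex f x /\ simplex f y.

Definition seg (R : realType) (n : nat) (x y : 'rV[R]_n) (s : R) : 'rV[R]_n :=
  (1 - s) *: x + s *: y.

(* The closed polygon with sides AB, BA', A'B', B'A. *)
Definition quadrilateral (R : realType) (n : nat) (A B A' B' : 'rV[R]_n) :
    set 'rV[R]_n :=
  [set x | exists2 s, 0 <= s <= 1 &
     [\/ x = seg A B s, x = seg B A' s, x = seg A' B' s | x = seg B' A s]].

(* [S1] and [S2] are the closures of the two connected components of the
   complement of [C] in the surface. *)
Definition splits (R : realType) (n : nat) (K : {set {set 'I_n}})
    (C S1 S2 : set 'rV[R]_n) : Prop :=
  [/\ S1 `|` S2 = body K,
      S1 `&` S2 = C,
      S1 = closure (S1 `\` C) /\ S2 = closure (S2 `\` C),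
      S1 `\` C !=set0 /\ S2 `\` C !=set0
    & connected (S1 `\` C) /\ connected (S2 `\` C)].

(* Cutting along [C] cuts each triangle into the closures of the connected
   components of its complement; these are the faces lying in the part [S]. *)
Definition cut_faces (R : realType) (n : nat) (K : {set {set 'I_n}})
    (C S : set 'rV[R]_n) : set (set 'rV[R]_n) :=
  [set F | exists f x, [/\ f \in K, simplex f x, S x, ~ C x
                         & F = closure (connected_component (simplex f `\` C) x)]].

(* The sides of the boundary of the first part are glued affinely to the sides
   of the boundary of the second one: corners A, B, A', B' to A', B', A, B,
   respectively to A, B', A', B. *)
Definition twist_glued (R : realType) (n : nat) (A B A' B' x y : 'rV[R]_n) : Prop :=
  exists2 s, 0 <= s <= 1 &
    [\/ x = seg A B s /\ y = seg A' B' s,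
        x = seg B A' s /\ y = seg B' A s,
        x = seg A' B' s /\ y = seg A B s
      | x = seg B' A s /\ y = seg B A' s].

Definition reflect_glued (R : realType) (n : nat) (A B A' B' x y : 'rV[R]_n) : Prop :=
  exists2 s, 0 <= s <= 1 &
    [\/ x = seg A B s /\ y = seg A B' s,
        x = seg B A' s /\ y = seg B' A' s,
        x = seg A' B' s /\ y = seg A' B s
      | x = seg B' A s /\ y = seg B A s].

(* Cut along [C] into the parts [S1] ([inl]) and [S2] ([inr]), move the second
   part by [h], and glue the boundaries back together by [G].  The cut and
   twisted surface is the case where [h] is a half-turn and [G] is
   [twist_glued A B A' B']; the cut and reflected one is the case where [h] is a
   reflection and [G] is [reflect_glued A B A' B']. *)
Definition cut_reglue (R : realType) (n : nat) (K : {set {set 'I_n}})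
    (p : 'M[R]_(n, 3)) (C S1 S2 : set 'rV[R]_n)
    (h : 'rV[R]_3 -> 'rV[R]_3) (G : 'rV[R]_n -> 'rV[R]_n -> Prop) : polysurf R :=
  {| point := ('rV[R]_n + 'rV[R]_n)%type;
     points := [set z | match z with inl x => S1 x | inr x => S2 x end];
     faces := [set F | (exists2 D, cut_faces K C S1 D & F = inl @` D) \/
                       (exists2 D, cut_faces K C S2 D & F = inr @` D)];
     glued := fun z w =>
       match z, w with inl x, inr y => G x y | _, _ => False end;
     pos := fun z => match z with inl x => x *m p | inr x => h (x *m p) end |}.

Section SameFreedom.
Variables (R : realType) (n : nat) (K : {set {set 'I_n}}) (p0 : 'M[R]_(n, 3)).
Variables (A B A' B' : 'rV[R]_n) (S1 S2 : set 'rV[R]_n).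
Variables (h0 : 'rV[R]_3 -> 'rV[R]_3) (G : 'rV[R]_n -> 'rV[R]_n -> Prop).
Variable symmetry : ('rV[R]_3 -> 'rV[R]_3) ->
  'rV[R]_3 -> 'rV[R]_3 -> 'rV[R]_3 -> 'rV[R]_3 -> Prop.

Let P := tri_surface K p0.
Let P' := cut_reglue K p0 (quadrilateral A B A' B') S1 S2 h0 G.

Definition symmetry_at (p : point P -> 'rV[R]_3) (h : 'rV[R]_3 -> 'rV[R]_3) : Prop :=
  symmetry h (p A) (p B) (p A') (p B').

(* During [q] both parts move as they do during [p], the second one being
   transformed by a symmetry [h t] of the moving quadrilateral. *)
Definition corresponding (h : R -> 'rV[R]_3 -> 'rV[R]_3)
    (p : R -> point P -> 'rV[R]_3) (q : R -> point P' -> 'rV[R]_3) : Prop :=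
  [/\ forall x, h 0 x = h0 x,
      forall t, 0 <= t <= 1 -> symmetry_at (p t) (h t),
      forall t x, 0 <= t <= 1 -> S1 x -> q t (inl x) = p t x
    & forall t x, 0 <= t <= 1 -> S2 x -> q t (inr x) = h t (p t x)].

(* The axis (plane) of symmetry of the moving quadrilateral never becomes
   ambiguous.  It is ambiguous only for certain collinear positions; there it
   need not depend continuously on time. *)
Definition symmetry_determined (p : R -> point P -> 'rV[R]_3) : Prop :=
  forall t h1 h2, 0 <= t <= 1 -> symmetry_at (p t) h1 -> symmetry_at (p t) h2 ->
    forall x, h1 x = h2 x.

Definition no_face_cut : Prop :=
  forall f, f \in K -> simplex f `<=` S1 \/ simplex f `<=` S2.

(* The converse half is restricted to quadrilaterals running along edges:
   otherwise the parts of a cut triangle, which cannot be bent against each other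
   in the original surface, become separate faces with a hinge between them. *)
Definition same_freedom : Prop :=
  [/\ forall p, motion P p ->
        exists h q, [/\ corresponding h p q,
          forall t, 0 <= t <= 1 -> configuration P' (q t)
        & symmetry_determined p -> motion P' q /\ (nontrivial P p <-> nontrivial P' q)],
      flexible P -> flexible P'
    & no_face_cut ->
        (forall q, motion P' q ->
           exists h p, [/\ corresponding h p q,
             forall t, 0 <= t <= 1 -> configuration P (p t)
           & symmetry_determined p -> motion P p /\ (nontrivial P p <-> nontrivial P' q)]) /\
        (flexible P' -> flexible P)].

End SameFreedom.

(* Main.v *)
Require Import Defs.
From HB Require Import structures.
From mathcomp Require Import all_boot all_order all_algebra.
From mathcomp Require Import all_classical all_reals all_analysis.
From mathcomp Require Import ring lra.
Import Order.TTheory GRing.Theory Num.Theory.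
Import numFieldNormedType.Exports.
Local Open Scope classical_set_scope.
Local Open Scope ring_scope.
Set Implicit Arguments.
Unset Strict Implicit.
Unset Printing Implicit Defensive.

(** Put v = a' - a and let e, w be the vectors [axis1], [span2] of a placement of
    the quadrilateral.  Its symmetries are exactly the half-turns (reflections)
    with center [axis_center] and direction d orthogonal to v and w, where e is a
    multiple of d.  Equal side lengths make e orthogonal to v and w, so a symmetry
    exists at every time of a flex; it is unique, with direction e or cross v w,
    unless both vanish.  Hence it depends continuously on time as long as the
    [spread], the sum of the squared lengths of e and cross v w, is positive.
    The spread is invariant under rigid motions: if it is positive at time 0, a
    nontrivial flex is already nontrivial before the first time at which the
    spread vanishes.  If it vanishes at time 0, the corners are collinear, and
    both surfaces flex by turning one part about the common line. *)

Lemma dotE (R : realType) (x y : 'rV[R]_3) :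
  dot x y = x 0 0 * y 0 0 + x 0 1 * y 0 1 + x 0 2 * y 0 2.
Proof.
rewrite /dot !big_ord_recl big_ord0 addr0 addrA.
by congr (_ * _ + _ * _ + _ * _); congr (_ _ _); apply: val_inj.
Qed.

Lemma row3P (R : realType) (x y : 'rV[R]_3) :
  x 0 0 = y 0 0 -> x 0 1 = y 0 1 -> x 0 2 = y 0 2 -> x = y.
Proof.
move=> h0 h1 h2; apply/rowP; case=> [[|[|[|//]]] i3].
- by rewrite (_ : Ordinal i3 = 0) //; apply: val_inj.
- by rewrite (_ : Ordinal i3 = 1) //; apply: val_inj.
- by rewrite (_ : Ordinal i3 = 2) //; apply: val_inj.
Qed.

Definition cross (R : realType) (u v : 'rV[R]_3) : 'rV[R]_3 :=
  \row_j (if j == 0 then u 0 1 * v 0 2 - u 0 2 * v 0 1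
          else if j == 1 then u 0 2 * v 0 0 - u 0 0 * v 0 2
          else u 0 0 * v 0 1 - u 0 1 * v 0 0).

Ltac coords := rewrite ?dotE /cross; do ?[apply: row3P]; rewrite ?mxE /=.

Section Vectors.
Variable R : realType.
Implicit Types u v w x y c d : 'rV[R]_3.

Lemma dotC u v : dot u v = dot v u. Proof. coords; ring. Qed.
Lemma dotZl k u v : dot (k *: u) v = k * dot u v. Proof. coords; ring. Qed.
Lemma dotDl u v w : dot (u + v) w = dot u w + dot v w. Proof. coords; ring. Qed.
Lemma dot0l u : dot 0 u = 0. Proof. coords; ring. Qed.

Lemma dot_ge0 u : 0 <= dot u u.
Proof. by rewrite /dot sumr_ge0// => i _; rewrite -expr2 sqr_ge0. Qed.

Lemma dot_eq0 u : (dot u u == 0) = (u == 0).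
Proof.
apply/eqP/eqP => [|->]; last by rewrite dot0l.
rewrite /dot => /eqP; rewrite psumr_eq0; last by move=> i _; rewrite -expr2 sqr_ge0.
move=> /allP u0; apply/rowP => i; rewrite mxE; apply/eqP.
by have := u0 i; rewrite mem_index_enum mulf_eq0 orbb; apply.
Qed.

Lemma edist_eq x y x' y' : Defs.edist x y = Defs.edist x' y' <->
  dot (x - y) (x - y) = dot (x' - y') (x' - y').
Proof.
split=> [/eqP|]; last by rewrite /Defs.edist => ->.
by rewrite /Defs.edist eqr_sqrt ?dot_ge0// => /eqP.
Qed.

Lemma dot_orthogonal (Q : 'M[R]_3) u v : Q *m Q^T = 1%:M ->
  dot (u *m Q) (v *m Q) = dot u v.
Proof.
have dotM y z : dot y z = (y *m z^T) 0 0.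
  by rewrite /dot mxE; apply: eq_bigr => i _; rewrite mxE.
by move=> QQ; rewrite !dotM trmx_mul mulmxA -(mulmxA u) QQ mulmx1.
Qed.

Lemma double_cross u v w : cross u (cross v w) = dot u w *: v - dot u v *: w.
Proof. coords; ring. Qed.

Lemma dot_cross u v : dot (cross u v) (cross u v) =
  dot u u * dot v v - dot u v ^+ 2.
Proof. coords; ring. Qed.

Lemma cross_eq0 u v : cross u v = 0 -> dot u u *: v = dot u v *: u.
Proof.
move=> uv0; apply/eqP; rewrite -subr_eq0.
have := double_cross u u v; rewrite uv0 (_ : cross u 0 = 0); last by coords; ring.
by move/eqP; rewrite eq_sym -oppr_eq0 opprB.
Qed.

Lemma parallel d x : d != 0 -> dot d d *: x = dot x d *: d ->
  x = (dot x d / dot d d) *: d.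
Proof.
rewrite -dot_eq0 => d0 dx; rewrite mulrC -scalerA -dx scalerA mulVf// scale1r.
exact.
Qed.

Lemma exists_unit x : x != 0 ->
  exists u (s : R), [/\ s != 0, dot u u = 1 & x = s *: u].
Proof.
rewrite -dot_eq0 => x0; have s0 : 0 < dot x x by rewrite lt_def x0 dot_ge0.
have r0 : Num.sqrt (dot x x) != 0 by rewrite sqrtr_eq0 -ltNge.
exists ((Num.sqrt (dot x x))^-1 *: x), (Num.sqrt (dot x x)); split=> //.
  rewrite dotZl dotC dotZl mulrA -{3}(sqr_sqrtr (dot_ge0 x)) expr2.
  by field.
by rewrite scalerA divff// scale1r.
Qed.

Lemma exists_orth u v : exists w, [/\ dot w w = 1, dot u w = 0 & dot v w = 0].
Proof.
pose M := (col_mx u v)^T.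
have : kermx M != 0.
  rewrite -mxrank_eq0 mxrank_ker -lt0n subn_gt0.
  by apply: leq_ltn_trans (rank_leq_col _) _.
case/rowV0Pn => x /sub_kermxP xM /exists_unit [w [s [s0 ww xE]]].
have wM : w *m M = 0.
  by move: xM; rewrite xE -scalemxAl => /eqP; rewrite scaler_eq0 (negPf s0) => /eqP.
have wd (z : 'rV[R]_3) : w *m z^T = 0 -> dot z w = 0.
  move=> /rowP/(_ 0); rewrite !mxE => zw; rewrite -[RHS]zw /dot.
  by apply: eq_bigr => i _; rewrite !mxE mulrC.
move: wM; rewrite /M tr_col_mx mul_mx_row -row_mx0.
by move=> /eq_row_mx [uw vw]; exists w; split=> //; apply: wd.
Qed.

End Vectors.

(** * Half-turns and reflections *)

Definition axial (R : realType) (k : bool) (c d x : 'rV[R]_3) : 'rV[R]_3 :=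
  if k then c + (2 * dot (x - c) d / dot d d) *: d - (x - c)
  else x - (2 * dot (x - c) d / dot d d) *: d.

Definition symmetry_of (R : realType) (k : bool) :=
  if k then @half_turn_symmetry R else @reflection_symmetry R.

Definition partner (T : Type) (k : bool) (a a' : T) : T := if k then a' else a.

Section Symmetry.
Variables (R : realType) (k : bool).
Implicit Types (a b c d u v w x y : 'rV[R]_3) (h : 'rV[R]_3 -> 'rV[R]_3).

Definition axis_center a a' : 'rV[R]_3 := if k then 2^-1 *: (a + a') else a.

Definition axis1 a b a' b' : 'rV[R]_3 := if k then a + a' - b - b' else b - b'.

Definition span2 a b b' : 'rV[R]_3 := if k then b' - b else b + b' - a - a.

Definition axis2 a b a' b' := cross (a' - a) (span2 a b b').

Definition is_axis a b a' b' d :=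
  [/\ dot (a' - a) d = 0, dot (span2 a b b') d = 0
    & dot d d *: axis1 a b a' b' = dot (axis1 a b a' b') d *: d].

Lemma axialK c d x : d != 0 -> axial k c d (axial k c d x) = x.
Proof.
rewrite -dot_eq0 /axial dotE => d0.
by case: k; coords; field.
Qed.

Lemma axial_iso c d x y : d != 0 ->
  dot (axial k c d x - axial k c d y) (axial k c d x - axial k c d y) =
  dot (x - y) (x - y).
Proof.
rewrite -dot_eq0 /axial dotE => d0.
by case: k; coords; field.
Qed.

Lemma axial_seg c d x y s :
  axial k c d (seg x y s) = seg (axial k c d x) (axial k c d y) s.
Proof. by rewrite /axial /seg; case: k; coords; ring. Qed.

Lemma axialZ c d x (s : R) : s != 0 -> d != 0 ->
  axial k c (s *: d) x = axial k c d x.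
Proof.
rewrite -dot_eq0 => s0 d0; have sd (z : 'rV[R]_3) :
    (2 * dot z (s *: d) / dot (s *: d) (s *: d)) *: (s *: d) =
    (2 * dot z d / dot d d) *: d.
  rewrite scalerA; congr (_ *: _).
  by rewrite [dot z _]dotC !dotZl [dot d (s *: d)]dotC dotZl [dot d z]dotC; field; rewrite d0.
by rewrite /axial !sd.
Qed.

Lemma axial_center c d c' x : d != 0 ->
  (if k then dot d d *: (c' - c) = dot (c' - c) d *: d else dot (c' - c) d = 0) ->
  axial k c' d x = axial k c d x.
Proof.
move=> d0; rewrite /axial; case: k => [/(parallel d0)|] H.
  have -> : c' = c + (dot (c' - c) d / dot d d) *: d by rewrite -H addrC subrK.
  set s := _ / _; move: d0; rewrite -dot_eq0 dotE => d0.
  by coords; field.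
have -> : dot (x - c') d = dot (x - c) d; last by [].
by apply/eqP; rewrite -subr_eq0 -oppr_eq0 -H; apply/eqP; coords; ring.
Qed.

Lemma axial_conj (Q : 'M[R]_3) e c d x : Q *m Q^T = 1%:M ->
  axial k (c *m Q + e) (d *m Q) (x *m Q + e) = axial k c d x *m Q + e.
Proof.
move=> QQ; have sub : x *m Q + e - (c *m Q + e) = (x - c) *m Q.
  by rewrite mulmxBl opprD addrACA subrr addr0.
rewrite /axial sub !dot_orthogonal//; set s := _ / _; case: k; rewrite scalemxAl.
  by rewrite (mulmxBl (c + _)) (mulmxDl c) [RHS]addrAC (addrAC (c *m Q) e).
by rewrite (mulmxBl x (s *: d)) addrAC.
Qed.

Lemma symmetryP h a b a' b' : symmetry_of k h a b a' b' <->
  exists d, [/\ d != 0, is_axis a b a' b' d & h =1 axial k (axis_center a a') d].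
Proof.
have unit_neq0 u : dot u u = 1 -> u != 0 by rewrite -dot_eq0 => ->; rewrite oner_eq0.
have axialC := axial_center; have axZ := axialZ; have axK := axialK.
rewrite /symmetry_of /is_axis /axis1 /span2 /axis_center; move: axialC axZ axK.
case: k => axialC axZ axK; split.
- move=> [[c [u [uu hE]]] [ha _ hb _]]; exists u; have u0 := unit_neq0 _ uu.
  have {}hE : h =1 axial true c u.
    by move=> x; rewrite hE /half_turn /axial uu divr1.
  have u1 := u0; move: u1 ha hb; rewrite -dot_eq0 dotE !hE /axial dotE => u1 <- <-.
  split=> // [|x]; first by split; coords; field.
  by rewrite hE; apply/esym/axialC => //; coords; field.
- move=> [d [d0 [vd wd xd] hE]]; have [u [s [s0 uu dE]]] := exists_unit d0.
  have u0 := unit_neq0 _ uu.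
  have ha : h a = a'.
    rewrite hE /axial (_ : dot _ d = 0).
      by rewrite mulr0 mul0r scale0r addr0; coords; field.
    by rewrite (_ : a - _ = - 2^-1 *: (a' - a)) ?dotZl ?vd ?mulr0//; coords; field.
  have hb : h b = b'.
    have := parallel d0 xd; set r := _ / _ => xE.
    have b'E : b' = a + a' - b - r *: d by rewrite -xE; coords; ring.
    rewrite hE /axial (_ : _ / _ = - r); first by rewrite b'E; coords; field.
    move: wd; rewrite b'E (_ : _ - b = (- 2) *: (b - 2^-1 *: (a + a')) - r *: d).
      rewrite (dotDl (_ *: _)) -(scaleNr r) (dotZl _ (b - _)) (dotZl (- r)) => wd; move: d0; rewrite -dot_eq0 => d0; apply: (mulIf d0); rewrite divfK //; lra.
    by coords; field.
  split; last by split=> //; rewrite -?ha -?hb !hE axK.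
  exists (2^-1 *: (a + a')), u; split=> // x.
  by rewrite hE dE axZ // /axial uu divr1.
- move=> [[c [u [uu ac a'c hE]]] [hb _]]; exists u; have u0 := unit_neq0 _ uu.
  have {}hE : h =1 axial false c u.
    by move=> x; rewrite hE /reflection /axial uu divr1.
  have u1 := u0; move: u1 hb; rewrite -dot_eq0 dotE !hE /axial dotE => u1 <-.
  split=> // [|x]; last by rewrite hE; apply/esym/axialC.
  split; last by coords; field.
    transitivity (dot (a' - c) u - dot (a - c) u); last by rewrite a'c ac subr0.
    by coords; ring.
  transitivity (- 2 * dot (a - c) u); last by rewrite ac mulr0.
  by coords; field.
- move=> [d [d0 [vd wd xd] hE]]; have [u [s [s0 uu dE]]] := exists_unit d0.
  have u0 := unit_neq0 _ uu.
  have hb : h b = b'.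
    have := parallel d0 xd; set r := _ / _ => xE.
    have b'E : b' = b - r *: d by rewrite -xE; coords; ring.
    rewrite hE /axial (_ : _ / _ = r) //.
    move: wd; rewrite b'E (_ : _ - a = 2 *: (b - a) - r *: d).
      rewrite (dotDl (_ *: _)) -(scaleNr r) (dotZl _ (b - _)) (dotZl (- r)) => wd; move: d0; rewrite -dot_eq0 => d0; apply: (mulIf d0); rewrite divfK //; lra.
    by coords; field.
  split; last by split=> //; rewrite -hb !hE axK.
  exists a, u; split=> // [||x]; first by coords; ring.
    move: vd; rewrite dE [dot _ (s *: u)]dotC dotZl => /eqP.
    by rewrite mulf_eq0 (negPf s0) dotC => /eqP.
  by rewrite hE dE axZ // /axial uu divr1.
Qed.

End Symmetry.

Section SymmetryTheory.
Variables (R : realType) (k : bool).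
Implicit Types (a b c d e u v w x y : 'rV[R]_3) (h : 'rV[R]_3 -> 'rV[R]_3).

Definition balanced a b a' b' :=
  dot (a - b) (a - b) =
    dot (partner k a a' - b') (partner k a a' - b') /\
  dot (b - a') (b - a') =
    dot (b' - partner k a' a) (b' - partner k a' a).

Lemma balanced_orth a b a' b' : balanced a b a' b' ->
  dot (axis1 k a b a' b') (a' - a) = 0 /\
  dot (axis1 k a b a' b') (span2 k a b b') = 0.
Proof.
rewrite /balanced /axis1 /span2 /partner; case: k => -[].
  by coords => h1 h2; split; lra.
by coords => h1 h2; split; lra.
Qed.

Lemma exists_symmetry a b a' b' : balanced a b a' b' ->
  exists h, symmetry_of k h a b a' b'.
Proof.
move=> /balanced_orth [xv xw].
have [d [d0 dax]] : exists d, d != 0 /\ is_axis k a b a' b' d.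
  have [x0|x0] := eqVneq (axis1 k a b a' b') 0.
    have [d [dd vd wd]] := exists_orth (a' - a) (span2 k a b b').
    exists d; split; last by split; rewrite // x0 dot0l scale0r scaler0.
    by rewrite -dot_eq0 dd oner_eq0.
  by exists (axis1 k a b a' b'); split=> //; split; rewrite // dotC.
by exists (axial k (axis_center k a a') d); apply/symmetryP; exists d.
Qed.

Section Given.
Variables (h : 'rV[R]_3 -> 'rV[R]_3) (a b a' b' : 'rV[R]_3).
Hypothesis hs : symmetry_of k h a b a' b'.

Lemma symmetryK x : h (h x) = x.
Proof. by case/symmetryP: hs => d [d0 _ hE]; rewrite !hE axialK. Qed.

Lemma symmetry_iso x y : dot (h x - h y) (h x - h y) = dot (x - y) (x - y).
Proof. by case/symmetryP: hs => d [d0 _ hE]; rewrite !hE axial_iso. Qed.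

Lemma symmetry_seg x y s : h (seg x y s) = seg (h x) (h y) s.
Proof. by case/symmetryP: hs => d [d0 _ hE]; rewrite !hE axial_seg. Qed.

Lemma symmetry_b : h b = b'.
Proof. by move: hs; rewrite /symmetry_of; case: k => [] [] _ []. Qed.

Lemma symmetry_b' : h b' = b.
Proof. by rewrite -symmetry_b symmetryK. Qed.

Lemma symmetry_a : h a = partner k a a'.
Proof.
move: (symmetryP k h a b a' b') hs; rewrite /symmetry_of /partner.
case: k => H hs'; first by case: hs' => _ [].
have [d [d0 _ ->]] := (proj1 H) hs'; rewrite /axial /axis_center subrr.
by rewrite dot0l mulr0 mul0r scale0r subr0.
Qed.

Lemma symmetry_a' : h a' = partner k a' a.
Proof.
move: (symmetryP k h a b a' b') hs; rewrite /symmetry_of /partner.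
case: k => H hs'; first by case: hs' => _ [].
have [d [d0 [vd _ _] ->]] := (proj1 H) hs'; rewrite /axial /axis_center vd.
by rewrite mulr0 mul0r scale0r subr0.
Qed.

Lemma symmetry_balanced : balanced a b a' b'.
Proof.
rewrite /balanced -symmetry_a -symmetry_a' -symmetry_b.
by rewrite !symmetry_iso.
Qed.

Lemma symmetry_axial e : e != 0 ->
  e = axis1 k a b a' b' \/ e = axis2 k a b a' b' ->
  h =1 axial k (axis_center k a a') e.
Proof.
move=> e0 eE; have [d [d0 [vd wd xd] hE]] := (proj1 (symmetryP k h a b a' b')) hs.
have de : dot d d *: e = dot e d *: d.
  case: eE => ->; first by [].
  rewrite [in RHS]dotC; apply: cross_eq0; rewrite double_cross.
  by rewrite [dot d _]dotC [dot d (_ - _)]dotC vd wd !scale0r subrr.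
move=> x; rewrite hE [in RHS](parallel d0 de) axialZ//.
apply: contraNneq e0 => s0.
by rewrite (parallel d0 de) s0 scale0r.
Qed.

End Given.

Definition spread a b a' b' := dot (axis1 k a b a' b') (axis1 k a b a' b') +
  dot (axis2 k a b a' b') (axis2 k a b a' b').

Lemma spread_neq0 a b a' b' : spread a b a' b' != 0 ->
  axis1 k a b a' b' != 0 \/ axis2 k a b a' b' != 0.
Proof.
rewrite /spread; have [-> |] := eqVneq (axis1 k a b a' b') 0; last by left.
by rewrite dot0l add0r dot_eq0; right.
Qed.

Lemma symmetry_unique h1 h2 a b a' b' : spread a b a' b' != 0 ->
  symmetry_of k h1 a b a' b' -> symmetry_of k h2 a b a' b' -> h1 =1 h2.
Proof.
move=> /spread_neq0 [] e0 hs1 hs2 x.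
  by rewrite (symmetry_axial hs1 e0) ?(symmetry_axial hs2 e0)//; left.
by rewrite (symmetry_axial hs1 e0) ?(symmetry_axial hs2 e0)//; right.
Qed.

Definition on_line c t x := exists s : R, x = c + s *: t.

Lemma spread0_line a b a' b' : spread a b a' b' = 0 ->
  exists t, [/\ dot t t = 1, on_line a t b, on_line a t a' & on_line a t b'] /\
   exists h1 h2 x, [/\ symmetry_of k h1 a b a' b', symmetry_of k h2 a b a' b'
                     & h1 x <> h2 x].
Proof.
move=> /eqP; rewrite /spread paddr_eq0 ?dot_ge0// !dot_eq0 => /andP[/eqP x0 /eqP n0].
have [t [tt [[s1 vE] [s2 wE]]]] : exists t, dot t t = 1 /\
    (exists s, a' - a = s *: t) /\ (exists s, span2 k a b b' = s *: t).
  have [v0|/[dup] v0 /exists_unit[t [s [s0 tt vE]]]] := eqVneq (a' - a) 0.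
    have [w0|/exists_unit[t [s [s0 tt ->]]]] := eqVneq (span2 k a b b') 0.
      have [t [tt _ _]] := exists_orth a a.
      by exists t; rewrite v0 w0; do !split=> //; exists 0; rewrite scale0r.
    by exists t; rewrite v0; do !split=> //; [exists 0; rewrite scale0r|exists s].
  exists t; do !split=> //; first by exists s.
  have wv : dot (a' - a) (a' - a) *: span2 k a b b' =
      dot (span2 k a b b') (a' - a) *: (a' - a).
    by rewrite [in RHS]dotC; exact: cross_eq0.
  have := parallel v0 wv; set r := _ / _ => ->.
  by exists (r * s); rewrite vE scalerA.
have [u [uu tu _]] := exists_orth t t.
have axis_orth d : dot t d = 0 -> is_axis k a b a' b' d.
  by move=> td; rewrite /is_axis vE wE x0 !dotZl td dot0l !mulr0 scaler0 scale0r.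
have u0 : u != 0 by rewrite -dot_eq0 uu oner_eq0.
have uu2 : dot (cross t u) (cross t u) = 1 by rewrite dot_cross tt uu tu; ring.
have u20 : cross t u != 0 by rewrite -dot_eq0 uu2 oner_eq0.
have tu2 : dot t (cross t u) = 0 by coords; ring.
have uu20 : dot u (cross t u) = 0 by coords; ring.
exists t; split; last first.
  exists (axial k (axis_center k a a') u), (axial k (axis_center k a a') (cross t u)).
  exists (axis_center k a a' + u); split.
  - by apply/symmetryP; exists u; split=> //; exact: axis_orth.
  - by apply/symmetryP; exists (cross t u); split=> //; exact: axis_orth.
  have cu (c : 'rV[R]_3) : c + u - c = u by rewrite addrC addKr.
  move=> /eqP; apply/negP; rewrite -subr_eq0 /axial cu uu uu20.
  rewrite mulr1 mulr0 mul0r scale0r divr1.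
  set y := (X in X == 0); suff -> : y = (if k then 2 else - 2) *: u.
    by rewrite scaler_eq0 negb_or u0 andbT; case: k; rewrite ?oppr_eq0 pnatr_eq0.
  by rewrite /y; move: (axis_center _ _ _) => c; case: k; coords; ring.
move: x0 vE wE; rewrite /axis1 /span2; case: k => x0 vE wE.
  have a'E : a' = a + s1 *: t by rewrite -vE addrC subrK.
  have bE : b = a + ((s1 - s2) / 2) *: t.
    rewrite mulrC -scalerA scalerBl -vE -wE.
    by rewrite -[LHS]addr0 -(scaler0 _ (2^-1 : R)) -x0; coords; field.
  have b'E : b' = a + ((s1 - s2) / 2 + s2) *: t.
    by rewrite scalerDl addrA -bE -wE addrC subrK.
  by split=> //; [exists ((s1 - s2) / 2)|exists s1|exists ((s1 - s2) / 2 + s2)].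
have a'E : a' = a + s1 *: t by rewrite -vE addrC subrK.
have b'E : b' = b by apply/eqP; rewrite eq_sym -subr_eq0 x0.
have bE : b = a + (s2 / 2) *: t.
  by rewrite mulrC -scalerA -wE b'E; coords; field.
by split=> //; [exists (s2 / 2)|exists s1|exists (s2 / 2); rewrite b'E].
Qed.

End SymmetryTheory.

(** * Rigid motions and rotations about a line *)

Section RigidMotions.
Variables (R : realType) (k : bool).
Implicit Types (a b c d e t u v w x y : 'rV[R]_3) (h : 'rV[R]_3 -> 'rV[R]_3).

Lemma rigid_iso g x y : rigid_motion g ->
  dot (g x - g y) (g x - g y) = dot (x - y) (x - y).
Proof.
move=> [Q [e [QQ _ gE]]]; rewrite !gE opprD addrACA subrr addr0 -mulmxBl.
exact: dot_orthogonal.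
Qed.

Section Frame.
Variables (Q : 'M[R]_3) (e a b a' b' : 'rV[R]_3).
Hypothesis QQ : Q *m Q^T = 1%:M.
Let g x := x *m Q + e.

Let gB x y : g x - g y = (x - y) *m Q.
Proof. by rewrite /g opprD addrACA subrr addr0 -mulmxBl. Qed.

Let axis1_rigid : axis1 k (g a) (g b) (g a') (g b') = axis1 k a b a' b' *m Q.
Proof.
rewrite /axis1; case: k; rewrite ?gB// -addrA -opprD.
by rewrite -(addrA (a + a')) -opprD opprD addrACA !gB -mulmxDl opprD addrACA.
Qed.

Let span2_rigid : span2 k (g a) (g b) (g b') = span2 k a b b' *m Q.
Proof.
rewrite /span2; case: k; rewrite ?gB//.
by rewrite -addrA -opprD opprD addrACA !gB -mulmxDl -[in RHS](addrA _ (- a)) [in RHS]addrACA.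
Qed.

Let axis_center_rigid : axis_center k (g a) (g a') = g (axis_center k a a').
Proof.
rewrite /axis_center; case: k => //; rewrite /g addrACA -mulmxDl scalerDr scalemxAl.
by congr (_ + _); coords; field.
Qed.

Lemma spread_rigid : spread k (g a) (g b) (g a') (g b') = spread k a b a' b'.
Proof.
by rewrite /spread /axis2 !dot_cross axis1_rigid span2_rigid gB !dot_orthogonal.
Qed.

Lemma symmetry_rigid h : symmetry_of k h a b a' b' ->
  exists h', symmetry_of k h' (g a) (g b) (g a') (g b') /\
             forall x, h' (g x) = g (h x).
Proof.
move=> /symmetryP [d [d0 [vd wd xd] hE]].
exists (axial k (axis_center k (g a) (g a')) (d *m Q)); split; last first.
  by move=> x; rewrite axis_center_rigid hE axial_conj.
apply/symmetryP; exists (d *m Q); split=> //.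
  by rewrite -dot_eq0 dot_orthogonal// dot_eq0.
split; rewrite ?gB ?span2_rigid ?axis1_rigid ?dot_orthogonal//.
by rewrite !scalemxAl xd.
Qed.

End Frame.

Definition turn c t (co si : R) x : 'rV[R]_3 :=
  c + dot (x - c) t *: t + co *: (x - c - dot (x - c) t *: t)
    + si *: cross t (x - c).

Lemma turn_line c t co si x : dot t t = 1 -> on_line c t x -> turn c t co si x = x.
Proof.
move=> tt [s ->]; have -> : turn c t co si (c + s *: t) = c + dot (s *: t) t *: t +
    co *: (s *: t - dot (s *: t) t *: t) + si *: cross t (s *: t).
  by rewrite /turn (_ : c + s *: t - c = s *: t)// addrC addKr.
rewrite dotZl tt mulr1 subrr scaler0.
rewrite (_ : cross t _ = 0) ?scaler0 ?addr0//.
by coords; ring.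
Qed.

Lemma turn0 c t x : turn c t 1 0 x = x.
Proof. by rewrite /turn; coords; ring. Qed.

Lemma turn_iso c t co si x y : dot t t = 1 -> co ^+ 2 + si ^+ 2 = 1 ->
  dot (turn c t co si x - turn c t co si y) (turn c t co si x - turn c t co si y)
  = dot (x - y) (x - y).
Proof.
move=> tt cs; set z := x - y.
have -> : turn c t co si x - turn c t co si y =
    dot z t *: t + co *: (z - dot z t *: t) + si *: cross t z.
  by rewrite /turn /z; coords; ring.
transitivity (dot z t ^+ 2 * dot t t +
    co ^+ 2 * (dot z z - 2 * dot z t ^+ 2 + dot z t ^+ 2 * dot t t) +
    2 * co * (dot z t ^+ 2 - dot z t ^+ 2 * dot t t) +
    si ^+ 2 * (dot t t * dot z z - dot z t ^+ 2)); first by coords; ring.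
rewrite tt (_ : si ^+ 2 = 1 - co ^+ 2); last by rewrite -cs addrAC subrr add0r.
by ring.
Qed.

Lemma turn_moves c t x y : dot t t = 1 ->
  cross t (x - c) != 0 -> cross t (y - c) != 0 ->
  dot (x - turn c t (-1) 0 y) (x - turn c t (-1) 0 y) = dot (x - y) (x - y) ->
  dot (x - turn c t 0 1 y) (x - turn c t 0 1 y) = dot (x - y) (x - y) -> False.
Proof.
move=> tt; set u := x - c; set v := y - c => u0 v0.
have -> : x - turn c t (-1) 0 y = u - (2 * dot v t) *: t + v.
  by rewrite /turn -/v /u; coords; ring.
have -> : x - turn c t 0 1 y = u - dot v t *: t - cross t v.
  by rewrite /turn -/v /u; coords; ring.
have -> : x - y = u - v by rewrite /u /v; coords; ring.
move=> H1 H2.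
have E1 : dot u v = dot u t * dot v t.
  move: H1; have -> : dot (u - (2 * dot v t) *: t + v) (u - (2 * dot v t) *: t + v) =
     dot (u - v) (u - v) + 4 * (dot u v - dot u t * dot v t) +
     4 * dot v t ^+ 2 * (dot t t - 1) by coords; ring.
  by rewrite tt => H1; lra.
have E2 : dot u (cross t v) = 0.
  move: H2; have -> : dot (u - dot v t *: t - cross t v) (u - dot v t *: t - cross t v) =
     dot (u - v) (u - v) + 2 * (dot u v - dot u t * dot v t) - 2 * dot u (cross t v) +
     (dot v t ^+ 2 + dot v v) * (dot t t - 1) - 0 by coords; ring.
  by rewrite tt E1 => H2; lra.
have : dot (cross t u) (cross t u) * dot (cross t v) (cross t v) =
  (dot t t * dot u v - dot u t * dot v t) ^+ 2 + dot u (cross t v) ^+ 2 * dot t t.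
  by coords; ring.
rewrite E1 E2 tt mul1r subrr !expr0n /= mul0r addr0 => /eqP.
by rewrite mulf_eq0 !dot_eq0 (negPf u0) (negPf v0).
Qed.

End RigidMotions.

Section Convergence.
Variables (R : realType) (T : Type) (F : set_system T).
Hypothesis FF : Filter F.
Implicit Types (f g : T -> 'rV[R]_3) (l m : 'rV[R]_3).

Lemma cvg_coord f l i : f @ F --> l -> f t 0 i @[t --> F] --> l 0 i.
Proof.
move=> fl; apply: (@cvg_comp _ _ _ f (fun y : 'rV[R]_3 => y 0 i) _ _ _ fl).
exact: coord_continuous.
Qed.

Lemma cvg_dot f g l m : f @ F --> l -> g @ F --> m ->
  dot (f t) (g t) @[t --> F] --> dot l m.
Proof.
move=> fl gm; rewrite dotE; under eq_cvg do rewrite dotE.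
by apply: cvgD; [apply: cvgD|]; apply: cvgM; apply: cvg_coord.
Qed.

Lemma crossE (u v : 'rV[R]_3) : cross u v =
  (u 0 1 * v 0 2 - u 0 2 * v 0 1) *: delta_mx 0 0 +
  (u 0 2 * v 0 0 - u 0 0 * v 0 2) *: delta_mx 0 1 +
  (u 0 0 * v 0 1 - u 0 1 * v 0 0) *: delta_mx 0 2.
Proof. by coords; ring. Qed.

Lemma cvg_cross f g l m : f @ F --> l -> g @ F --> m ->
  cross (f t) (g t) @[t --> F] --> cross l m.
Proof.
move=> fl gm; rewrite crossE; under eq_cvg do rewrite crossE.
by do 2?[apply: cvgD]; apply: cvgZr_tmp; apply: cvgB; apply: cvgM; apply: cvg_coord.
Qed.

Lemma cvg_axial k f g j l m n : f @ F --> l -> g @ F --> m -> m != 0 ->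
  j @ F --> n ->
  axial k (f t) (g t) (j t) @[t --> F] --> axial k l m n.
Proof.
move=> fl gm m0 jn.
have c : (2 * dot (j t - f t) (g t) / dot (g t) (g t)) *: g t @[t --> F] -->
    (2 * dot (n - l) m / dot m m) *: m.
  apply: cvgZ => //; apply: cvgM; last first.
    by apply: cvgV; [rewrite dot_eq0|apply: cvg_dot].
  by apply: cvgM; [exact: cvg_cst|apply: cvg_dot => //; apply: cvgB].
by rewrite /axial; case: k; [apply: cvgB; [apply: cvgD|apply: cvgB]|apply: cvgB].
Qed.

End Convergence.

(** * Simplices and parts of a split surface *)

Section Simplices.
Variables (R : realType) (n : nat).
Implicit Types (f g : {set 'I_n}) (x y : 'rV[R]_n).

Lemma seg_coord x y (s : R) i : seg x y s 0 i = (1 - s) * x 0 i + s * y 0 i.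
Proof. by rewrite /seg !mxE. Qed.

Lemma segC x y (s : R) : seg x y s = seg y x (1 - s).
Proof. by rewrite /seg subKr addrC. Qed.

Lemma seg0 x y : seg x y 0 = x.
Proof. by rewrite /seg subr0 scale1r scale0r addr0. Qed.

Lemma seg1 x y : seg x y 1 = y.
Proof. by rewrite segC subrr seg0. Qed.

Lemma seg_mul m (p : 'M[R]_(n, m)) x y (s : R) : seg x y s *m p = seg (x *m p) (y *m p) s.
Proof. by rewrite /seg mulmxDl -!scalemxAl. Qed.

Lemma simplex_seg f x y (s : R) : simplex f x -> simplex f y -> 0 <= s <= 1 ->
  simplex f (seg x y s).
Proof.
move=> [x0 x1 xf] [y0 y1 yf] /andP[s0 s1]; split=> [i||i fi].
- by rewrite seg_coord addr_ge0// mulr_ge0// subr_ge0.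
- under eq_bigr do rewrite seg_coord.
  by rewrite big_split/= -!mulr_sumr x1 y1 !mulr1 subrK.
- by rewrite seg_coord xf// yf// !mulr0 addr0.
Qed.

(* Barycentric coordinates are nonnegative, so a coordinate that vanishes at an
   interior point of a segment vanishes at both ends. *)
Lemma simplex_mid f g1 g2 x y (s : R) : simplex g1 x -> simplex g2 y -> 0 < s < 1 ->
  simplex f (seg x y s) -> simplex f x /\ simplex f y.
Proof.
move=> [x0 x1 _] [y0 y1 _] /andP[s0 s1] [_ _ sf].
have zero i : i \notin f -> x 0 i = 0 /\ y 0 i = 0.
  move=> /sf /eqP; rewrite seg_coord.
  rewrite paddr_eq0 ?mulr_ge0// ?subr_ge0// ?ltW//.
  rewrite !mulf_eq0 subr_eq0 (gt_eqF s1) (gt_eqF s0) /=.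
  by move=> /andP[/eqP -> /eqP ->].
by split; split=> // i /zero[].
Qed.

Lemma simplex_vertex f i : i \in f -> simplex f (delta_mx 0 i : 'rV[R]_n).
Proof.
move=> fi; split=> [j||j fj]; first by rewrite mxE ler0n.
  rewrite (bigD1 i)//= mxE !eqxx big1 ?addr0// => j /negPf ji.
  by rewrite mxE ji andbF.
by rewrite mxE (_ : (j == i) = false) ?andbF//; apply: contraNF fj => /eqP ->.
Qed.

Lemma coord_cts i : continuous (fun x : 'rV[R]_n => x 0 i).
Proof. by move=> x; exact: coord_continuous. Qed.

Lemma simplex_closed f : closed (simplex f : set 'rV[R]_n).
Proof.
rewrite (_ : simplex f = (\bigcap_i [set x | 0 <= x 0 i]) `&`
  [set x | \sum_i x 0 i = 1] `&` (\bigcap_(i in [set i | i \notin f]) [set x | x 0 i = 0])).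
  apply: closedI; first apply: closedI.
  - apply: closed_bigI => i _.
    apply: (@preimage_closed _ _ (fun x : 'rV[R]_n => x 0 i) [set y | 0 <= y]).
      by move=> x _; exact: coord_cts.
    exact: closed_ge.
  - apply: (@preimage_closed _ _ (fun x : 'rV[R]_n => \sum_i x 0 i) [set y | y = 1]).
      move=> x _; apply: cvg_big => [||i _]; [exact: add_continuous|exact: (@nbhs_filter 'rV[R]_n)|exact: coord_cts].
    exact: closed_eq.
  - apply: closed_bigI => i _.
    apply: (@preimage_closed _ _ (fun x : 'rV[R]_n => x 0 i) [set y | y = 0]).
      by move=> x _; exact: coord_cts.
    exact: closed_eq.
apply/seteqP; split=> x /= [].
  by move=> x0 x1 xf; split; [split=> // i _; exact: x0|move=> i fi; exact: xf].
by move=> [x0 x1] xf; split=> // i; exact: x0.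
Qed.

Lemma seg_cts x y : continuous (seg x y : R -> 'rV[R]_n).
Proof.
move=> s; apply: cvgD; apply: cvgZr_tmp; last exact: cvg_id.
by apply: cvgB; [exact: cvg_cst|exact: cvg_id].
Qed.

End Simplices.

Section Parts.
Variables (R : realType) (n : nat) (K : {set {set 'I_n}}).
Hypothesis card_face : forall f, f \in K -> #|f| = 3%N.
Implicit Types (f g : {set 'I_n}) (x y : 'rV[R]_n) (C : set 'rV[R]_n).

Lemma splitsC C S1 S2 : splits K C S1 S2 -> splits K C S2 S1.
Proof.
move=> [bU cI [c1 c2] [n1 n2] [k1 k2]].
by split; rewrite // 1?setUC// 1?setIC.
Qed.

Lemma part_closed C S1 S2 : splits K C S1 S2 -> closed S1.
Proof. by move=> [_ _ [-> _] _ _]; exact: closed_closure. Qed.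

Lemma part_sub C S1 S2 : splits K C S1 S2 -> S1 `<=` body K.
Proof. by move=> [<- _ _ _ _] x S1x; left. Qed.

Lemma curve_sub C S1 S2 : splits K C S1 S2 -> C `<=` S1.
Proof. by move=> [_ <- _ _ _] x []. Qed.

Lemma face_off_line f (p : 'M[R]_(n, 3)) c t : f \in K -> realization K p ->
  dot t t = 1 -> exists2 i, i \in f & cross t (row i p - c) != 0.
Proof.
move=> fK hp tt; apply: contrapT => H.
have {}H i : i \in f -> cross t (row i p - c) = 0.
  by move=> fi; apply/eqP; apply: contra_notT H => ?; exists i.
have := card_face fK; rewrite cardE.
have := enum_uniq f; have: {subset enum f <= f} by move=> i; rewrite mem_enum.
case: (enum f) => [|i [|j [|k [|]]]]//= ef.
rewrite !inE negb_or !andbT => /andP[/andP[ij ik] jk] _.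
have fi : i \in f by apply: ef; rewrite inE eqxx.
have fj : j \in f by apply: ef; rewrite !inE eqxx orbT.
have fk : k \in f by apply: ef; rewrite !inE eqxx !orbT.
have rf := hp f i j k fK fi fj fk ij jk ik.
have sub l : l \in f -> (row l p - row i p <= t)%MS.
  move=> fl; have : cross t (row l p - row i p) = 0.
    have -> : cross t (row l p - row i p) = cross t (row l p - c) - cross t (row i p - c).
      by coords; ring.
    by rewrite !H// subrr.
  by move=> /cross_eq0; rewrite tt scale1r => ->; exact: scalemx_sub.
have : (\rank (col_mx (row j p - row i p) (row k p - row i p)) <= \rank t)%N.
  by apply: mxrankS; rewrite col_mx_sub !sub.
by rewrite (eqP rf) => /leq_trans/(_ (rank_leq_row t)).
Qed.

Lemma vertex_mul m (p : 'M[R]_(n, m)) i : delta_mx 0 i *m p = row i p.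
Proof. by rewrite rowE. Qed.

Lemma part_off_line C S1 S2 (p : 'M[R]_(n, 3)) c t : splits K C S1 S2 ->
  realization K p -> dot t t = 1 ->
  exists2 x, S1 x & cross t (x *m p - c) != 0.
Proof.
move=> hS hp tt; have [bU cI _ [[x [S1x Cx]] _] _] := hS.
have nS2 : ~ S2 x by move=> S2x; apply: Cx; rewrite -cI.
have [f fK fx] := part_sub hS S1x.
have [i fi iH] := face_off_line c fK hp tt.
have [x0|] := eqVneq (cross t (x *m p - c)) 0; last by exists x.
have /nbhs_ballP[e /= e0 He] : \forall s \near (0 : R),
    (~` S2) (seg x (delta_mx 0 i) s).
  apply: (@seg_cts R n x (delta_mx 0 i) 0).
  rewrite seg0; apply: open_nbhs_nbhs; split=> //.
  by apply: closed_openC; exact: part_closed (splitsC hS).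
pose s := Num.min (e / 2) 1.
have s0 : 0 < s by rewrite lt_min divr_gt0//= ltr01.
have s1 : s <= 1 by rewrite ge_min lexx orbT.
have se : s < e by rewrite gt_min ltr_pdivrMr// ltr_pMr// ltr1n.
have nS2s : ~ S2 (seg x (delta_mx 0 i) s).
  by apply: He; rewrite /ball/= sub0r normrN gtr0_norm.
have S1s : S1 (seg x (delta_mx 0 i) s).
  have : body K (seg x (delta_mx 0 i) s).
    exists f => //; apply: simplex_seg => //; first exact: simplex_vertex.
    by rewrite ltW.
  by rewrite -bU => -[].
exists (seg x (delta_mx 0 i) s) => //.
have -> : cross t (seg x (delta_mx 0 i) s *m p - c) =
    (1 - s) *: cross t (x *m p - c) + s *: cross t (row i p - c).
  by rewrite seg_mul vertex_mul /seg; move: (x *m p) (row i p) => y z; coords; ring.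
by rewrite x0 scaler0 add0r scaler_eq0 negb_or gt_eqF.
Qed.

Lemma uncut_face C S1 S2 x : splits K C S1 S2 -> no_face_cut K S1 S2 -> S1 x ->
  exists f, [/\ f \in K, simplex f x & simplex f `<=` S1].
Proof.
move=> hS hcut; move=> S1x; have [bU cI [S1E _] _ _] := hS; rewrite {}S1E in S1x.
have : closure (\bigcup_(f in [set f | f \in K /\ simplex f `<=` S1]) simplex f) x.
  move: S1x; apply: closureS => y [S1y Cy]; have [f fK fy] := part_sub hS S1y.
  exists f => //; split=> //; case: (hcut f fK) => // /(_ y fy) S2y.
  by case: Cy; rewrite -cI.
rewrite -(proj1 (closure_id _)).
  by case=> f [fK fS] fx; exists f; split.
apply: closed_bigcup; first exact: finite_finset.
by move=> f _; exact: simplex_closed.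
Qed.

Lemma interior_off_curve C S1 S2 f x : splits K C S1 S2 -> f \in K ->
  simplex f `<=` S1 -> (forall i, i \in f -> 0 < x 0 i) -> ~ C x.
Proof.
move=> hS fK fS x0 Cx; have [bU cI [_ S2E] _ _] := hS.
have : closure (S2 `\` C) x by rewrite -S2E; exact: curve_sub (splitsC hS) _ Cx.
have near_pos : nbhs x [set y : 'rV[R]_n | forall i, i \in f -> 0 < y 0 i].
  apply: (@filter_forall _ _ (fun i => [set y : 'rV[R]_n | i \in f -> 0 < y 0 i])
    (nbhs x)) => i.
  case: (boolP (i \in f)) => fi; last exact: filterE.
  have H := @coord_cts R n i x [set z | 0 < z].
  have : nbhs x [set y : 'rV[R]_n | 0 < y 0 i].
    by apply: H; apply: open_nbhs_nbhs; split; [exact: open_gt|exact: x0].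
  by apply: (@filterS _ (nbhs x) (@nbhs_filter 'rV[R]_n x)) => y /=.
move=> /(_ _ near_pos) [].
move=> y [[S2y Cy] y0]; have [g gK [gy0 gy1 gy]] := part_sub (splitsC hS) S2y.
have fg : f \subset g.
  apply/fintype.subsetP => i fi; apply: contraT => /gy yi.
  by have := y0 i fi; rewrite yi ltxx.
have fgE : f = g by apply/eqP; rewrite eqEcard fg !card_face.
by apply: Cy; rewrite -cI; split=> //; apply: fS; rewrite fgE.
Qed.

Definition barycenter f : 'rV[R]_n := \row_i ((i \in f)%:R / #|f|%:R).

Lemma barycenter_gt0 f i : f \in K -> i \in f -> 0 < barycenter f 0 i.
Proof. by move=> fK fi; rewrite mxE fi card_face// divr_gt0// ltr0n. Qed.

Lemma simplex_barycenter f : f \in K -> simplex f (barycenter f).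
Proof.
move=> fK; split=> [i||i /negPf fi].
- by rewrite mxE divr_ge0 ?ler0n.
- under eq_bigr do rewrite mxE.
  rewrite -mulr_suml -natr_sum (_ : (\sum_i (i \in f) = #|f|)%N); last first.
    by rewrite -sum1_card [RHS]big_mkcond; apply: eq_bigr => i _; case: (i \in f).
  by rewrite card_face// divff// pnatr_eq0.
- by rewrite mxE fi mul0r.
Qed.

Lemma cut_face_uncut C S1 S2 f : splits K C S1 S2 -> f \in K ->
  simplex f `<=` S1 -> cut_faces K C S1 (simplex f).
Proof.
move=> hS fK fS; set z := barycenter f.
have fz := simplex_barycenter fK.
have off y (s : R) : simplex f y -> 0 < s <= 1 -> ~ C (seg y z s).
  move=> [y0 _ _] /andP[s0 s1].
  apply: (interior_off_curve hS fK fS) => i fi.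
  rewrite seg_coord ltr_wpDl ?mulr_gt0 ?mulr_ge0 ?subr_ge0//.
  exact: barycenter_gt0.
have Cz : ~ C z by rewrite -(seg1 z z); apply: off => //; rewrite ltr01 lexx.
exists f, z; split=> //; first exact: fS.
apply/seteqP; split=> [y fy|]; last first.
  apply: subset_trans (closureS (@connected_component_sub _ _ _)) _.
  apply: subset_trans (closureS (@subDsetl _ _ _)) _.
  by rewrite -(proj1 (closure_id _))//; exact: simplex_closed.
move=> B By.
have /nbhs_ballP[e /= e0 He] : \forall s \near (0 : R), B (seg y z s).
  by apply: (@seg_cts R n y z 0); rewrite seg0.
pose s := Num.min (e / 2) 1.
have s0 : 0 < s by rewrite lt_min divr_gt0//= ltr01.
have s1 : s <= 1 by rewrite ge_min lexx orbT.
have se : s < e by rewrite gt_min ltr_pdivrMr// ltr_pMr// ltr1n.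
exists (seg y z s); split; last first.
  by apply: He; rewrite /ball/= sub0r normrN gtr0_norm.
exists (seg y z @` `[s, 1]); last first.
  by exists s => //=; rewrite in_itv/= lexx s1.
split.
- by exists 1; rewrite ?seg1//= in_itv/= s1 lexx.
- move=> _ [r /= + <-]; rewrite in_itv/= => /andP[sr r1].
  have r0 := lt_le_trans s0 sr.
  by split; [apply: simplex_seg => //; rewrite ltW|apply: off => //; rewrite r0].
- apply: connected_continuous_connected; first exact: segment_connected.
  by apply: continuous_subspaceT; exact: seg_cts.
Qed.

Lemma cut_face_sub C S1 D : cut_faces K C S1 D ->
  exists2 f, f \in K & D `<=` simplex f.
Proof.
move=> [f [x [fK fx _ _ ->]]]; exists f => //.
apply: subset_trans (closureS (@connected_component_sub _ _ _)) _.
apply: subset_trans (closureS (@subDsetl _ _ _)) _.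
by rewrite -(proj1 (closure_id _))//; exact: simplex_closed.
Qed.

End Parts.

(** * Paths of symmetries *)

Section SymmetryConvergence.
Variables (R : realType) (k : bool) (T : Type) (F : set_system T).
Hypothesis FF : Filter F.
Implicit Types (a b c : T -> 'rV[R]_3).

Lemma cvg_axis_center a c la lc : a @ F --> la -> c @ F --> lc ->
  axis_center k (a t) (c t) @[t --> F] --> axis_center k la lc.
Proof.
by move=> al cl; rewrite /axis_center; case: k => //; apply: cvgZl_tmp; exact: cvgD.
Qed.

Variables (a b a' b' : T -> 'rV[R]_3) (la lb la' lb' : 'rV[R]_3).
Hypotheses (al : a @ F --> la) (bl : b @ F --> lb).
Hypotheses (al' : a' @ F --> la') (bl' : b' @ F --> lb').

Lemma cvg_axis1 :
  axis1 k (a t) (b t) (a' t) (b' t) @[t --> F] --> axis1 k la lb la' lb'.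
Proof. by rewrite /axis1; case: k; do ?[exact: cvgD|apply: cvgB => //]. Qed.

Lemma cvg_axis2 :
  axis2 k (a t) (b t) (a' t) (b' t) @[t --> F] --> axis2 k la lb la' lb'.
Proof.
apply: cvg_cross; first exact: cvgB.
by rewrite /span2; case: k; do ?[exact: cvgD|apply: cvgB => //].
Qed.

Lemma cvg_spread :
  spread k (a t) (b t) (a' t) (b' t) @[t --> F] --> spread k la lb la' lb'.
Proof.
by apply: cvgD; apply: cvg_dot; do ?[exact: cvg_axis1|exact: cvg_axis2].
Qed.

Lemma cvg_symmetry (h : T -> 'rV[R]_3 -> 'rV[R]_3) h0 (y : T -> 'rV[R]_3) (z : 'rV[R]_3) :
  spread k la lb la' lb' != 0 -> symmetry_of k h0 la lb la' lb' ->
  (\forall t \near F, symmetry_of k (h t) (a t) (b t) (a' t) (b' t)) ->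
  y @ F --> z -> h t (y t) @[t --> F] --> h0 z.
Proof.
move=> /spread_neq0 sp hs0 hs yz.
have key (e : T -> 'rV[R]_3) (le : 'rV[R]_3) : e @ F --> le -> le != 0 ->
   (forall t, e t = axis1 k (a t) (b t) (a' t) (b' t)) /\ le = axis1 k la lb la' lb' \/
   (forall t, e t = axis2 k (a t) (b t) (a' t) (b' t)) /\ le = axis2 k la lb la' lb' ->
   h t (y t) @[t --> F] --> h0 z.
  move=> ele le0 eE; rewrite (symmetry_axial hs0 le0); last by case: eE => -[]; [left|right].
  have : axial k (axis_center k (a t) (a' t)) (e t) (y t) @[t --> F] -->
      axial k (axis_center k la la') le z.
    by apply: cvg_axial => //; exact: cvg_axis_center.
  apply: cvg_trans; apply: near_eq_cvg.
  have e0 : \forall t \near F, e t != 0 by exact: cvgr_neq0 ele le0.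
  apply: filterS2 hs e0 => t hst et0; apply/esym/(symmetry_axial hst et0).
  by case: eE => -[]; [left|right].
case: sp => e0; [apply: (key _ _ cvg_axis1 e0)|apply: (key _ _ cvg_axis2 e0)].
  by left.
by right.
Qed.

End SymmetryConvergence.

Section Paths.
Variable R : realType.

Lemma within_unitP (S : topologicalType) (f : R -> S) :
  {within `[0, 1], continuous f} <->
  (forall t : R, 0 <= t <= 1 -> f @ within `[0, 1] (nbhs t) --> f t).
Proof.
rewrite subspace_continuousP; split=> H t.
  by move=> t01; apply: H; rewrite /= in_itv.
by rewrite /= in_itv /= => t01; apply: H.
Qed.

Lemma cvg_rescale (s t : R) : 0 <= s <= 1 ->
  (s * r) @[r --> within `[0, 1] (nbhs t)] --> within `[0, 1] (nbhs (s * t)).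
Proof.
move=> /andP[s0 s1] U /= HU.
have cv : (s * r) @[r --> t] --> s * t by apply: cvgM; [exact: cvg_cst|exact: cvg_id].
have near_t : nbhs t [set r | s * r \in `[0, 1] -> U (s * r)] by exact: (cv _ HU).
rewrite /nbhs /= /within /=; apply: (@filterS _ (nbhs t) _ _ _ _ near_t) => r /= H.
rewrite in_itv/= => /andP[r0 r1]; apply: H.
by rewrite in_itv/= mulr_ge0//= mulr_ile1.
Qed.

Variables (P : polysurf R) (k : bool) (a b a' b' : Defs.point P).
Hypotheses (Pa : points P a) (Pb : points P b) (Pa' : points P a') (Pb' : points P b').

Let sp (q : Defs.point P -> 'rV[R]_3) := spread k (q a) (q b) (q a') (q b').

Lemma rescale_motion q s : motion P q -> 0 <= s <= 1 ->
  motion P (fun t => q (s * t)).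
Proof.
move=> [q0 qc qcts] /andP[s0 s1]; split=> [x Px|t /andP[t0 t1]|x Px].
- by rewrite mulr0 q0.
- by apply: qc; rewrite mulr_ge0//= mulr_ile1.
apply/within_unitP => t /andP[t0 t1].
apply: (@cvg_comp _ _ _ (fun r => s * r) (fun r => q r x)).
  by apply: cvg_rescale; rewrite s0.
apply: (proj1 (within_unitP (fun r => q r x)) (qcts x Px)).
by rewrite mulr_ge0//= mulr_ile1.
Qed.

Lemma determined_flex q : motion P q -> nontrivial P q -> sp (pos P) != 0 ->
  exists q', [/\ motion P q', nontrivial P q' &
    forall t, 0 <= t <= 1 -> sp (q' t) != 0].
Proof.
move=> qm [t1 [t101 nt1]] sp0; have [q0 qc qcts] := qm.
have sp00 : sp (q 0) = sp (pos P) by rewrite /sp !q0.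
suff [s [s01 sN ns]] : exists s, [/\ 0 <= s <= 1,
    (forall t, 0 <= t <= s -> sp (q t) != 0) &
    ~ exists g, rigid_motion g /\ forall x, points P x -> q s x = g (pos P x)].
  exists (fun t => q (s * t)); split; first exact: rescale_motion.
    by exists 1; split; rewrite ?mulr1 ?lexx ?ler01.
  move=> t /andP[t0 t1']; apply: sN; case/andP: s01 => s0 s1.
  by rewrite mulr_ge0//= ler_piMr.
have [E0|/forallNP En] := pselect (exists t, 0 <= t <= t1 /\ sp (q t) = 0); last first.
  exists t1; split=> // t t01; apply/eqP => H; exact: (En t).
pose E := [set t | 0 <= t <= 1 /\ sp (q t) = 0].
have hE : has_inf E.
  case: E0 => t [/andP[t0 tt1] H]; split.
    by exists t; split=> //; rewrite t0 (le_trans tt1)//; case/andP: t101.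
  by exists 0 => x [/andP[]].
have m0 : 0 <= inf E by apply: lb_le_inf => [|x [/andP[]]//]; case: hE.
have m1 : inf E <= 1.
  case: hE => -[t [t01 Ht]] hl; apply: (@le_trans _ _ t); last by case/andP: t01.
  by apply: ge_inf.
have m01 : 0 <= inf E <= 1 by rewrite m0.
have cvgsp (t : R) : 0 <= t <= 1 -> sp (q r) @[r --> within `[0, 1] (nbhs t)] --> sp (q t).
  by move=> t01; apply: cvg_spread; apply: (proj1 (within_unitP (q^~ _))) => //; apply: qcts.
have near_neq (z : R) : sp (q (inf E)) != z ->
    exists2 e, 0 < e & forall r, 0 <= r <= 1 -> `|inf E - r| < e -> sp (q r) != z.
  move=> Hz; have : \forall r \near within `[0, 1] (nbhs (inf E)), sp (q r) - z != 0.
    apply: (@cvgr_neq0 _ _ _ _ _ _ (sp (q (inf E)) - z)); last by rewrite subr_eq0.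
    by apply: cvgB; [exact: cvgsp|exact: cvg_cst].
  move=> /nbhs_ballP[e /= e0 He]; exists e => // r r01 re.
  by rewrite -subr_eq0; apply: He => //=; rewrite in_itv.
have spm : sp (q (inf E)) = 0.
  apply: contrapT => /eqP /near_neq [e e0 He].
  have [z [z01 Ez] zm] := inf_adherent e0 hE.
  have : sp (q z) != 0.
    apply: He => //; rewrite distrC ger0_norm ?subr_ge0 ?ltrBlDl//.
    by apply: ge_inf => //; case: hE.
  by rewrite Ez eqxx.
have [e e0 He] : exists2 e, 0 < e & forall r, 0 <= r <= 1 -> `|inf E - r| < e ->
    sp (q r) != sp (pos P).
  by apply: near_neq; rewrite spm eq_sym.
have mgt0 : 0 < inf E.
  by rewrite lt_neqAle m0 andbT; apply: contraNneq sp0 => m0'; rewrite -sp00 {1}m0' spm.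
pose s := Num.max (inf E - e / 2) 0.
have s0 : 0 <= s by rewrite le_max lexx orbT.
have sm : s < inf E by rewrite gt_max mgt0 andbT ltrBlDr ltrDl divr_gt0.
have s01 : 0 <= s <= 1 by rewrite s0 (le_trans (ltW sm)).
exists s; split=> //.
  move=> t /andP[t0 ts]; apply/eqP => H.
  have : inf E <= t.
    by apply: ge_inf; [case: hE|split=> //; rewrite t0 (le_trans ts)//; case/andP: s01].
  by rewrite leNgt (le_lt_trans ts sm).
move=> [g [[Q [c [QQ _ gE]]] qg]].
have : sp (q s) != sp (pos P).
  have es : inf E - e / 2 <= s by rewrite le_max lexx.
  by apply: He => //; rewrite ger0_norm ?subr_ge0 ?ltW//; lra.
by rewrite /sp !qg// !gE spread_rigid// eqxx.
Qed.

End Paths.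

(** * Reglued surfaces *)

Definition reglue (R : realType) (k : bool) (n : nat) :
    'rV[R]_n -> 'rV[R]_n -> 'rV[R]_n -> 'rV[R]_n -> 'rV[R]_n -> 'rV[R]_n -> Prop :=
  if k then @twist_glued R n else @reflect_glued R n.

Lemma dot_subC (R : realType) (x y : 'rV[R]_3) :
  dot (x - y) (x - y) = dot (y - x) (y - x).
Proof. by coords; ring. Qed.

Lemma seg_unique (R : realType) (x y z x' y' z' : 'rV[R]_3) s : z = seg x y s ->
  dot (x' - y') (x' - y') = dot (x - y) (x - y) ->
  dot (z' - x') (z' - x') = dot (z - x) (z - x) ->
  dot (z' - y') (z' - y') = dot (z - y) (z - y) -> z' = seg x' y' s.
Proof.
(* Stewart's theorem *)
have stewart (u v w : 'rV[R]_3) : dot (w - seg u v s) (w - seg u v s) =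
  (1 - s) * dot (w - u) (w - u) + s * dot (w - v) (w - v)
  - s * (1 - s) * dot (u - v) (u - v) by rewrite /seg; coords; ring.
move=> zE xy zx zy; apply/eqP; rewrite -subr_eq0 -dot_eq0 stewart xy zx zy.
by rewrite -stewart zE subrr dot0l.
Qed.

Lemma on_line_seg (R : realType) (c t x y : 'rV[R]_3) s :
  on_line c t x -> on_line c t y -> on_line c t (seg x y s).
Proof.
move=> [u ->] [v ->]; exists ((1 - s) * u + s * v).
by rewrite /seg; coords; ring.
Qed.

Section Quadrilateral.
Variables (R : realType) (n : nat) (p : 'M[R]_(n, 3)) (k : bool).
Variables (A B A' B' : 'rV[R]_n).
Implicit Types (r : 'rV[R]_n -> 'rV[R]_3) (h : 'rV[R]_3 -> 'rV[R]_3).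
Implicit Types (x y X Y : 'rV[R]_n).

Definition side_rigid r X Y :=
  dot (r X - r Y) (r X - r Y) = dot (X *m p - Y *m p) (X *m p - Y *m p) /\
  forall s, 0 <= s <= 1 -> r (seg X Y s) = seg (r X) (r Y) s.

Definition quad_rigid r :=
  [/\ side_rigid r A B, side_rigid r B A', side_rigid r A' B' & side_rigid r B' A].

Definition face_iso (f : {set 'I_n}) r := forall x y, simplex f x -> simplex f y ->
  dot (r x - r y) (r x - r y) = dot (x *m p - y *m p) (x *m p - y *m p).

Lemma face_side_rigid f r X Y : face_iso f r -> simplex f X -> simplex f Y ->
  side_rigid r X Y.
Proof.
move=> iso fX fY; split=> [|s s01]; first exact: iso.
have fs := simplex_seg fX fY s01.
by apply: (seg_unique (seg_mul p X Y s)); exact: iso.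
Qed.

Lemma quad_rigid_balanced h0 r : quad_rigid r ->
  symmetry_of k h0 (A *m p) (B *m p) (A' *m p) (B' *m p) ->
  balanced k (r A) (r B) (r A') (r B').
Proof.
move=> [[rAB _] [rBA' _] [rA'B' _] [rB'A _]] /symmetry_balanced.
rewrite /balanced /partner rAB rBA'; case: k => -[-> ->]; first by rewrite rA'B' rB'A.
rewrite (dot_subC (r A)) rB'A (dot_subC (r B')) rA'B'.
by split; exact: dot_subC.
Qed.

Lemma side_rigidC r X Y s : side_rigid r X Y -> 0 <= s <= 1 ->
  r (seg Y X s) = seg (r Y) (r X) s.
Proof.
move=> [_ H] /andP[s0 s1]; rewrite segC H; first by rewrite -segC.
by rewrite subr_ge0 s1 gerBl.
Qed.

Lemma glue_match h r x y : quad_rigid r ->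
  symmetry_of k h (r A) (r B) (r A') (r B') -> reglue k A B A' B' x y ->
  r x = h (r y).
Proof.
move=> [rAB rBA' rA'B' rB'A] hs.
have hb := symmetry_b hs; have hb' := symmetry_b' hs.
have ha := symmetry_a hs; have ha' := symmetry_a' hs; have hseg := symmetry_seg hs.
have cAB := side_rigidC rAB; have cBA' := side_rigidC rBA'.
have cA'B' := side_rigidC rA'B'; have cB'A := side_rigidC rB'A.
move: rAB rBA' rA'B' rB'A => [_ rAB] [_ rBA'] [_ rA'B'] [_ rB'A].
rewrite /reglue; move: ha ha'; rewrite /partner; case: k => ha ha'.
  by move=> [s s01 [] [-> ->]];
    rewrite ?rAB ?rBA' ?rA'B' ?rB'A// hseg ?ha ?ha' ?hb ?hb'.
move=> [s s01 [] [-> ->]];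
  by rewrite ?cAB ?cBA' ?cA'B' ?cB'A ?rAB ?rBA' ?rA'B' ?rB'A// hseg ?ha ?ha' ?hb ?hb'.
Qed.

Lemma glue_total x : quadrilateral A B A' B' x -> exists y, reglue k A B A' B' y x.
Proof.
move=> [s s01 xE]; rewrite /reglue.
case: k; case: xE => ->.
- by exists (seg A' B' s), s => //; constructor 3.
- by exists (seg B' A s), s => //; constructor 4.
- by exists (seg A B s), s => //; constructor 1.
- by exists (seg B A' s), s => //; constructor 2.
- exists (seg A B' s), (1 - s); last by constructor 4; rewrite -!segC.
  by case/andP: s01 => s0 s1; rewrite subr_ge0 s1 gerBl.
- exists (seg B' A' s), (1 - s); last by constructor 3; rewrite -!segC.
  by case/andP: s01 => s0 s1; rewrite subr_ge0 s1 gerBl.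
- exists (seg A' B s), (1 - s); last by constructor 2; rewrite -!segC.
  by case/andP: s01 => s0 s1; rewrite subr_ge0 s1 gerBl.
- exists (seg B A s), (1 - s); last by constructor 1; rewrite -!segC.
  by case/andP: s01 => s0 s1; rewrite subr_ge0 s1 gerBl.
Qed.

Lemma glue_sub x y : reglue k A B A' B' x y -> quadrilateral A B A' B' x.
Proof.
rewrite /reglue; case: k => -[s s01 xE]; exists s => //.
  by case: xE => -[-> _]; [constructor 1|constructor 2|constructor 3|constructor 4].
by case: xE => -[-> _]; [constructor 1|constructor 2|constructor 3|constructor 4].
Qed.

Lemma corners : [/\ quadrilateral A B A' B' A, quadrilateral A B A' B' B,
  quadrilateral A B A' B' A' & quadrilateral A B A' B' B'].
Proof.
split; exists 0; rewrite ?lexx ?ler01// !seg0.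
- by constructor 1.
- by constructor 2.
- by constructor 3.
- by constructor 4.
Qed.

End Quadrilateral.

Section TurningFlex.
Variable R : realType.

Lemma cvg_turn (c t x : 'rV[R]_3) (T : Type) (F : set_system T) (co si : T -> R) (a b : R) :
  Filter F -> co @ F --> a -> si @ F --> b ->
  turn c t (co r) (si r) x @[r --> F] --> turn c t a b x.
Proof.
move=> FF ca sb; apply: cvgD; last exact: cvgZr_tmp.
by apply: cvgD; [exact: cvg_cst|exact: cvgZr_tmp].
Qed.

Lemma turn_flexible (X : polysurf R) (M : set (Defs.point X)) (c t : 'rV[R]_3) :
  dot t t = 1 ->
  (forall F, faces X F -> (forall z, F z -> M z \/ on_line c t (pos X z)) \/
                          (forall z, F z -> ~ M z \/ on_line c t (pos X z))) ->
  (forall x y, glued X x y -> pos X x = pos X y /\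
                              (on_line c t (pos X x) \/ (M x <-> M y))) ->
  (exists x, [/\ points X x, ~ M x & cross t (pos X x - c) != 0]) ->
  (exists x, [/\ points X x, M x & cross t (pos X x - c) != 0]) ->
  flexible X.
Proof.
move=> tt faceM gluedM [x [Xx Mx x0]] [y [Xy My y0]].
pose rot r := turn c t (cos (pi * r)) (sin (pi * r)).
pose q (r : R) z := if `[< M z >] then rot r (pos X z) else pos X z.
have qM r z : M z \/ on_line c t (pos X z) -> q r z = rot r (pos X z).
  by move=> Mz; rewrite /q; case: asboolP => // nM; case: Mz => // lz; rewrite /rot turn_line.
have qN r z : ~ M z \/ on_line c t (pos X z) -> q r z = pos X z.
  by move=> Mz; rewrite /q; case: asboolP => // nM; case: Mz => // lz; rewrite /rot turn_line.
have riso r u v : dot (rot r u - rot r v) (rot r u - rot r v) = dot (u - v) (u - v).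
  by rewrite turn_iso// cos2Dsin2.
exists q; split.
  split=> [z _|r _|z _].
  - by rewrite /q /rot mulr0 cos0 sin0 turn0 if_same.
  - split=> [F /faceM[FM|FN] u v Fu Fv|u v /gluedM[uv [ul|uM]]].
    + by apply/edist_eq; rewrite !qM//; exact: FM.
    + by apply/edist_eq; rewrite !qN//; exact: FN.
    + by rewrite !qN//; right; rewrite // -uv.
    + by rewrite /q uv (asbool_equiv_eq uM).
  apply/within_unitP => r _; rewrite /q; case: asboolP => _; last exact: cvg_cst.
  have pr : (pi * s) @[s --> within `[0, 1] (nbhs r)] --> pi * r.
    by apply: cvgM; [exact: cvg_cst|exact: cvg_within].
  apply: cvg_turn; apply: (continuous_cvg _ _ pr).
    exact: continuous_cos.
  exact: continuous_sin.
apply: contrapT => nn.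
have dist r : 0 <= r <= 1 ->
    dot (pos X x - rot r (pos X y)) (pos X x - rot r (pos X y)) =
    dot (pos X x - pos X y) (pos X x - pos X y).
  move=> r01; have [g [gr gP]] : exists g, rigid_motion g /\
      forall z, points X z -> q r z = g (pos X z).
    by apply: contrapT => H; apply: nn; exists r.
  rewrite -[RHS](rigid_iso _ _ gr) -!gP// qN; last by left.
  by rewrite qM//; left.
apply: (turn_moves tt x0 y0).
  by have := dist 1; rewrite /rot mulr1 cospi sinpi; apply; rewrite lexx ler01.
have := dist 2^-1; rewrite /rot cos_pihalf sin_pihalf; apply.
by apply/andP; split; lra.
Qed.

End TurningFlex.

Section Reglued.
Variables (R : realType) (n : nat) (K : {set {set 'I_n}}) (p : 'M[R]_(n, 3)).
Variables (A B A' B' : 'rV[R]_n) (S1 S2 : set 'rV[R]_n).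
Variables (k : bool) (h0 : 'rV[R]_3 -> 'rV[R]_3).
Hypotheses (hK : triangulated_surface R K) (hp : realization K p).
Hypotheses (hA : on_edge K A) (hB : on_edge K B).
Hypotheses (hA' : on_edge K A') (hB' : on_edge K B').
Hypotheses (hAB : on_common_face K A B) (hBA' : on_common_face K B A').
Hypotheses (hA'B' : on_common_face K A' B') (hB'A : on_common_face K B' A).
Hypothesis hS : splits K (quadrilateral A B A' B') S1 S2.
Hypothesis hs0 : symmetry_of k h0 (A *m p) (B *m p) (A' *m p) (B' *m p).

Let P := tri_surface K p.
Let C := quadrilateral A B A' B'.
Let P' := cut_reglue K p C S1 S2 h0 (reglue k A B A' B').
Let V := 'rV[R]_3.

Let quad_at (F : V -> V -> V -> V -> Prop) (r : 'rV[R]_n -> V) :=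
  F (r A) (r B) (r A') (r B').

Let spr (r : 'rV[R]_n -> V) := spread k (r A) (r B) (r A') (r B').

Let card_face f : f \in K -> #|f| = 3%N.
Proof. by case: hK => H _ _ _; exact: H. Qed.

Let CS1 x : C x -> S1 x. Proof. exact: (curve_sub hS). Qed.
Let S1body x : S1 x -> body K x. Proof. exact: (part_sub hS). Qed.
Let S2body x : S2 x -> body K x. Proof. exact: (part_sub (splitsC hS)). Qed.

Lemma tri_configuration q :
  (forall f, f \in K -> face_iso p f q) -> configuration P q.
Proof.
move=> iso; split=> [_ [f fK ->] x y fx fy|x y ->//].
by apply/edist_eq; exact: (iso f).
Qed.

Lemma configuration_face q f : configuration P q -> f \in K -> face_iso p f q.
Proof.
move=> [iso _] fK x y fx fy; apply/edist_eq.
by apply: (iso (simplex f)) => //; exists f.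
Qed.

Lemma configuration_quad q : configuration P q -> quad_rigid p A B A' B' q.
Proof.
move=> qc; split.
- by case: hAB => f /(configuration_face qc) iso []; exact: face_side_rigid.
- by case: hBA' => f /(configuration_face qc) iso []; exact: face_side_rigid.
- by case: hA'B' => f /(configuration_face qc) iso []; exact: face_side_rigid.
- by case: hB'A => f /(configuration_face qc) iso []; exact: face_side_rigid.
Qed.

Lemma reglued_configuration (q : Defs.point P' -> V) :
  (forall f, f \in K -> face_iso p f (q \o inl) /\ face_iso p f (q \o inr)) ->
  (forall x y, reglue k A B A' B' x y -> q (inl x) = q (inr y)) ->
  configuration P' q.
Proof.
move=> iso gl; split; last by move=> [x|x] [y|y] //=; exact: gl.
move=> _ [] [D /cut_face_sub[f fK Df] ->] _ _ [x Dx <-] [y Dy <-]; apply/edist_eq.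
  by case: (iso f fK) => /(_ x y (Df _ Dx) (Df _ Dy)).
case: (iso f fK) => _ /(_ x y (Df _ Dx) (Df _ Dy)) /= ->.
by rewrite (symmetry_iso hs0).
Qed.

Lemma reglued_face (q : Defs.point P' -> V) f : configuration P' q -> f \in K ->
  (simplex f `<=` S1 -> face_iso p f (q \o inl)) /\
  (simplex f `<=` S2 -> face_iso p f (q \o inr)).
Proof.
move=> [iso _] fK; split=> fS x y fx fy.
  have F : faces P' (inl @` simplex f).
    by left; exists (simplex f) => //; exact: cut_face_uncut hS fK fS.
  by apply/edist_eq; apply: (iso _ F (inl x) (inl y)); [exists x|exists y].
have F : faces P' (inr @` simplex f).
  by right; exists (simplex f) => //; exact: cut_face_uncut (splitsC hS) fK fS.
rewrite -[RHS](symmetry_iso hs0).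
by apply/edist_eq; apply: (iso _ F (inr x) (inr y)); [exists x|exists y].
Qed.

Lemma spread_determined (r : R -> Defs.point P -> V) :
  (forall t, 0 <= t <= 1 -> spr (r t) != 0) ->
  @symmetry_determined R n K p A B A' B' (@symmetry_of R k) r.
Proof. by move=> sp t h1 h2 t01; exact: symmetry_unique (sp t t01). Qed.

Lemma determined_spread (r : R -> Defs.point P -> V) :
  @symmetry_determined R n K p A B A' B' (@symmetry_of R k) r ->
  forall t, 0 <= t <= 1 -> spr (r t) != 0.
Proof.
move=> det t t01; apply/eqP => /spread0_line [_ [_ [h1 [h2 [x [s1 s2]]]]]].
by apply; exact: (det t).
Qed.

(* At time 0 the symmetry has to be the given one. *)
Lemma exists_moving_symmetry (r : R -> 'rV[R]_n -> V) :
  (forall x, C x -> r 0 x = x *m p) ->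
  (forall t, 0 <= t <= 1 -> quad_rigid p A B A' B' (r t)) ->
  exists h : R -> V -> V, (forall x, h 0 x = h0 x) /\
    forall t, 0 <= t <= 1 -> quad_at (symmetry_of k (h t)) (r t).
Proof.
move=> r0 rq; have [CA CB CA' CB'] := corners A B A' B'.
have [h hP] : {h : R -> V -> V & forall t, (t = 0 -> h t =1 h0) /\
    (0 <= t <= 1 -> quad_at (symmetry_of k (h t)) (r t))}.
  apply: (@boolp.choice R (V -> V) (fun t g => (t = 0 -> g =1 h0) /\
    (0 <= t <= 1 -> quad_at (symmetry_of k g) (r t)))) => t; have [->|t0] := eqVneq t 0.
    by exists h0; split=> // _; rewrite /quad_at !r0.
  have [t01|] := boolP (0 <= t <= 1); last first.
    by exists h0; split=> // te; rewrite te eqxx in t0.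
  have [h hs] := exists_symmetry (quad_rigid_balanced (rq t t01) hs0).
  by exists h; split=> // te; rewrite te eqxx in t0.
by exists h; split=> [x|t]; [exact: (hP 0).1|exact: (hP t).2].
Qed.

Lemma corresponding_nontrivial (h : R -> V -> V) (r : R -> Defs.point P -> V)
    (q : R -> Defs.point P' -> V) :
  @corresponding R n K p A B A' B' S1 S2 h0 (reglue k A B A' B') (@symmetry_of R k) h r q ->
  (forall t, 0 <= t <= 1 -> spr (r t) != 0) ->
  (nontrivial P r <-> nontrivial P' q).
Proof.
move=> [h00 hs q1 q2] sp; have [CA CB CA' CB'] := corners A B A' B'.
suff H t : 0 <= t <= 1 ->
    (exists g, rigid_motion g /\ forall x, points P x -> r t x = g (pos P x)) <->
    (exists g, rigid_motion g /\ forall x, points P' x -> q t x = g (pos P' x)).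
  by split=> -[t [t01 nt]]; exists t; split=> // /(H t t01).
move=> t01.
have key g : rigid_motion g -> r t A = g (A *m p) -> r t B = g (B *m p) ->
    r t A' = g (A' *m p) -> r t B' = g (B' *m p) -> forall x, h t (g x) = g (h0 x).
  move=> [Q [c [QQ _ gE]]] rA rB rA' rB' x.
  have [h' [hs' h'E]] := symmetry_rigid c QQ hs0.
  rewrite !gE -h'E; move: (hs' ); rewrite -!gE -rA -rB -rA' -rB' => {}hs'.
  exact: symmetry_unique (sp t t01) (hs t t01) hs' _.
split=> -[g [gr gP]]; exists g; split=> //.
  move=> [x S1x|x S2x] /=; first by rewrite q1// gP//; exact: S1body.
  rewrite q2// gP//; last exact: S2body.
  by apply: key => //; apply: gP; apply: S1body; exact: CS1.
have gP1 x : S1 x -> r t x = g (x *m p).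
  by move=> S1x; rewrite -q1//; exact: (gP (inl x)).
move=> x Kx; have [bU _ _ _ _] := hS; move: Kx; rewrite /= -bU => -[S1x|S2x].
  exact: gP1.
rewrite -[LHS](symmetryK (hs t t01)) -q2//.
have -> : q t (inr x) = g (h0 (x *m p)) by exact: (gP (inr x)).
by rewrite key ?(symmetryK hs0)// gP1//; exact: CS1.
Qed.

Lemma twist_motion (r : R -> Defs.point P -> V) : motion P r ->
  exists h q, [/\
    @corresponding R n K p A B A' B' S1 S2 h0 (reglue k A B A' B') (@symmetry_of R k) h r q,
    forall t, 0 <= t <= 1 -> configuration P' (q t)
  & @symmetry_determined R n K p A B A' B' (@symmetry_of R k) r ->
      motion P' q /\ (nontrivial P r <-> nontrivial P' q)].
Proof.
move=> [r0 rc rcts]; have [CA CB CA' CB'] := corners A B A' B'.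
have rq t : 0 <= t <= 1 -> quad_rigid p A B A' B' (r t).
  by move=> t01; exact: configuration_quad (rc t t01).
have [h [h00 hs]] : exists h : R -> V -> V, (forall x, h 0 x = h0 x) /\
    forall t, 0 <= t <= 1 -> quad_at (symmetry_of k (h t)) (r t).
  by apply: exists_moving_symmetry => // x /CS1 /S1body; exact: r0.
pose q t (z : Defs.point P') := match z with inl x => r t x | inr x => h t (r t x) end.
have corr : @corresponding R n K p A B A' B' S1 S2 h0 (reglue k A B A' B')
    (@symmetry_of R k) h r q by split.
have qc t : 0 <= t <= 1 -> configuration P' (q t).
  move=> t01; apply: reglued_configuration => [f fK|x y].
    have iso := configuration_face (rc t t01) fK.
    by split=> // x y fx fy /=; rewrite (symmetry_iso (hs t t01)) iso.
  exact: glue_match (rq t t01) (hs t t01).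
exists h, q; split=> // /determined_spread sp; split; last exact: corresponding_nontrivial corr sp.
split=> //.
  move=> [x S1x|x S2x] /=; first by apply: r0; exact: S1body.
  by rewrite h00 r0//; exact: S2body.
have rct (x : 'rV[R]_n) (t : R) : S1 x \/ S2 x -> 0 <= t <= 1 ->
    r s x @[s --> within `[0, 1] (nbhs t)] --> r t x.
  move=> Sx; apply: (proj1 (within_unitP (r^~ x))); apply: rcts.
  by case: Sx; [exact: S1body|exact: S2body].
move=> [x S1x|x S2x]; apply/within_unitP => t t01 /=; first by apply: rct => //; left.
apply: (@cvg_symmetry _ k _ _ _ (r^~ A) (r^~ B) (r^~ A') (r^~ B')
  (r t A) (r t B) (r t A') (r t B')) => //; try by apply: rct => //; left; exact: CS1.
- exact: sp.
- exact: hs.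
- by apply: filterS (withinT `[0, 1] (nbhs_filter t)) => s; rewrite /= in_itv /=; exact: hs.
- by apply: rct => //; right.
Qed.

Lemma twist_flexible : spr (fun x => x *m p) != 0 -> flexible P -> flexible P'.
Proof.
move=> sp0 [r [rm rn]]; have [CA CB CA' CB'] := corners A B A' B'.
have [r' [r'm r'n sp]] : exists r', [/\ motion P r', nontrivial P r' &
    forall t, 0 <= t <= 1 -> spr (r' t) != 0].
  by apply: (determined_flex _ _ _ _ rm rn sp0); apply: S1body; exact: CS1.
have [h [q [_ _ H]]] := twist_motion r'm.
by have [qm [nn _]] := H (spread_determined sp); exists q; split=> //; exact: nn.
Qed.

Let on_edge_simplex (x : 'rV[R]_n) : on_edge K x -> exists e, simplex e x.
Proof. by move=> [e _ ex]; exists e. Qed.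

Section Uncut.
Hypothesis hcut : no_face_cut K S1 S2.

Let side_face X Y : on_edge K X -> on_edge K Y -> C (seg X Y 2^-1) ->
  exists f, [/\ f \in K, simplex f `<=` S1, simplex f X & simplex f Y].
Proof.
move=> /on_edge_simplex [e1 X1] /on_edge_simplex [e2 Y2] /CS1 S1m.
have [f [fK fm fS]] := uncut_face hS hcut S1m.
exists f; split=> //.
  by case: (simplex_mid X1 Y2 _ fm); rewrite //; apply/andP; split; lra.
by case: (simplex_mid X1 Y2 _ fm); rewrite //; apply/andP; split; lra.
Qed.

Lemma reglued_quad (q : Defs.point P' -> V) : configuration P' q ->
  quad_rigid p A B A' B' (q \o inl).
Proof.
move=> qc.
have half : 0 <= (2^-1 : R) <= 1 by apply/andP; split; lra.
have side X Y : on_edge K X -> on_edge K Y -> C (seg X Y 2^-1) ->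
    side_rigid p (q \o inl) X Y.
  move=> Xe Ye Cm; have [f [fK fS fX fY]] := side_face Xe Ye Cm.
  by apply: (@face_side_rigid _ _ _ f) => //; exact: (reglued_face qc fK).1.
split; apply: side => //; exists 2^-1 => //.
- by constructor 1.
- by constructor 2.
- by constructor 3.
- by constructor 4.
Qed.

Lemma untwist_motion (q : R -> Defs.point P' -> V) : motion P' q ->
  exists h r, [/\
    @corresponding R n K p A B A' B' S1 S2 h0 (reglue k A B A' B') (@symmetry_of R k) h r q,
    forall t, 0 <= t <= 1 -> configuration P (r t)
  & @symmetry_determined R n K p A B A' B' (@symmetry_of R k) r ->
      motion P r /\ (nontrivial P r <-> nontrivial P' q)].
Proof.
move=> [q0 qc qcts]; have [CA CB CA' CB'] := corners A B A' B'.
have rq t : 0 <= t <= 1 -> quad_rigid p A B A' B' (q t \o inl).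
  by move=> t01; exact: reglued_quad (qc t t01).
have [h [h00 hs]] : exists h : R -> V -> V, (forall x, h 0 x = h0 x) /\
    forall t, 0 <= t <= 1 -> quad_at (symmetry_of k (h t)) (q t \o inl).
  by apply: exists_moving_symmetry => // x /CS1; exact: (q0 (inl x)).
pose r t x : V := if `[< S1 x >] then q t (inl x) else h t (q t (inr x)).
have r1 t x : S1 x -> r t x = q t (inl x) by move=> /asboolP S1x; rewrite /r S1x.
have r2 t x : 0 <= t <= 1 -> S2 x -> r t x = h t (q t (inr x)).
  move=> t01 S2x; rewrite /r; case: asboolP => // S1x.
  have Cx : C x by case: hS => _; rewrite -/C => <-.
  have [y yx] := @glue_total R n k A B A' B' x Cx.
  have rE := glue_match (rq t t01) (hs t t01) yx.
  have [_ gl] := qc t t01.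
  have /= <- : q t (inl y) = q t (inr x) by exact: (gl (inl y) (inr x)).
  by rewrite -[q t (inl y)]/((q t \o inl) y) rE (symmetryK (hs t t01)).
have rK (x : 'rV[R]_n) : body K x -> S1 x \/ S2 x.
  by have [<- _ _ _ _] := hS.
have corr : @corresponding R n K p A B A' B' S1 S2 h0 (reglue k A B A' B')
    (@symmetry_of R k) h r q.
  split=> //.
  - by move=> t t01; rewrite /symmetry_at !r1; do ?exact: CS1; exact: hs.
  - by move=> t x t01 S1x; rewrite r1.
  - by move=> t x t01 S2x; rewrite r2// (symmetryK (hs t t01)).
have rc t : 0 <= t <= 1 -> configuration P (r t).
  move=> t01; apply: tri_configuration => f fK x y fx fy.
  have [iso1 iso2] := reglued_face (qc t t01) fK.
  case: (hcut fK) => fS.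
    by rewrite !r1; first exact: iso1; exact: fS.
  by rewrite !r2// ?(symmetry_iso (hs t t01)); first exact: iso2; exact: fS.
exists h, r; split=> //.
move=> /determined_spread sp; split; last exact: corresponding_nontrivial corr sp.
have qct (z : Defs.point P') (t : R) : points P' z -> 0 <= t <= 1 ->
    q s z @[s --> within `[0, 1] (nbhs t)] --> q t z.
  by move=> Pz; apply: (proj1 (within_unitP (q^~ z))); exact: qcts.
split=> // x Kx.
  have [S1x|S2x] := rK x Kx; first by rewrite r1//; exact: (q0 (inl x)).
  by rewrite r2 ?lexx ?ler01// h00 (q0 (inr x))//; exact: (symmetryK hs0).
apply/within_unitP => t t01; rewrite /r; case: asboolP => [S1x|S1x].
  exact: (qct (inl x)).
have S2x : S2 x by case: (rK x Kx).
have spt : spread k (q t (inl A)) (q t (inl B)) (q t (inl A')) (q t (inl B')) != 0.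
  by have := sp t t01; rewrite /spr !r1//; exact: CS1.
apply: (@cvg_symmetry _ k _ _ _ (q^~ (inl A)) (q^~ (inl B)) (q^~ (inl A')) (q^~ (inl B'))
  (q t (inl A)) (q t (inl B)) (q t (inl A')) (q t (inl B'))) => //;
  try by apply: qct => //=; exact: CS1.
- exact: hs.
- by apply: filterS (withinT `[0, 1] (nbhs_filter t)) => s; rewrite /= in_itv /=; exact: hs.
Qed.

Lemma untwist_flexible : spr (fun x => x *m p) != 0 -> flexible P' -> flexible P.
Proof.
move=> sp0 [q [qm qn]]; have [CA CB CA' CB'] := corners A B A' B'.
have [q' [q'm q'n sp]] : exists q', [/\ motion P' q', nontrivial P' q' &
    forall t, 0 <= t <= 1 -> spr (q' t \o inl) != 0].
  by apply: (@determined_flex _ P' k (inl A) (inl B) (inl A') (inl B') _ _ _ _ _ qm qn sp0);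
    exact: CS1.
have [h [r [corr _ H]]] := untwist_motion q'm.
have spr_r t : 0 <= t <= 1 -> spr (r t) != 0.
  move=> t01; have := sp t t01; rewrite /spr /=.
  by case: corr => _ _ q1 _; rewrite !q1//; exact: CS1.
by have [rm [_ nn]] := H (spread_determined spr_r); exists r; split=> //; exact: nn.
Qed.

End Uncut.

Lemma pos_quad : quad_rigid p A B A' B' (fun x => x *m p).
Proof. by split; split=> // s _; exact: seg_mul. Qed.

Let spread0_curve : spr (fun x => x *m p) = 0 ->
  exists t, dot t t = 1 /\ forall x, C x -> on_line (A *m p) t (x *m p).
Proof.
move=> /spread0_line [t [[tt lB lA' lB'] _]]; exists t; split=> // x [s _].
have lA : on_line (A *m p) t (A *m p) by exists 0; rewrite scale0r addr0.
by move=> [] ->; rewrite seg_mul; exact: on_line_seg.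
Qed.

Lemma twist_collinear : spr (fun x => x *m p) = 0 -> flexible P'.
Proof.
move=> /spread0_curve [t [tt Cl]]; set c := A *m p.
apply: (@turn_flexible R P' [set z | if z is inr _ then True else False] c t tt).
- move=> _ [] [D _ ->]; [right|left]; move=> _ [z _ <-]; first by left.
  by left.
- move=> [x|x] [y|y] //= xy; split.
    exact: (glue_match pos_quad hs0 xy).
  by left; apply: Cl; exact: glue_sub xy.
- have [x S1x x0] := part_off_line card_face c hS hp tt.
  by exists (inl x); split.
have t'1 : dot (h0 (c + t) - h0 c) (h0 (c + t) - h0 c) = 1.
  by rewrite (symmetry_iso hs0) addrC addKr.
have [x S2x x0] := part_off_line card_face (h0 c) (splitsC hS) hp t'1.
exists (inr x); split=> //=; apply: contraNneq x0.
move=> /cross_eq0; rewrite tt scale1r; set s := dot _ _ => xE.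
have -> : x *m p = h0 (seg c (c + t) s).
  rewrite -[LHS](symmetryK hs0); congr h0.
  by rewrite -[LHS](subrK c) xE /seg; coords; ring.
by rewrite (symmetry_seg hs0) /seg; move: (h0 _) (h0 _) => u v; apply/eqP; coords; ring.
Qed.

Lemma untwist_collinear : no_face_cut K S1 S2 -> spr (fun x => x *m p) = 0 ->
  flexible P.
Proof.
move=> hcut /spread0_curve [t [tt Cl]]; set c := A *m p.
have S12 x : S1 x -> S2 x -> C x by have [_ + _ _ _] := hS; rewrite -/C => <-.
apply: (@turn_flexible R P (~` S1) c t tt).
- move=> _ [f fK ->]; case: (hcut f fK) => fS; [right|left] => z /fS Sz.
    by left=> /(_ Sz).
  have [S1z|] := pselect (S1 z); last by left.
  by right; apply: Cl; exact: S12.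
- by move=> x _ <-; split=> //; right.
- have [x S1x x0] := part_off_line card_face c hS hp tt.
  by exists x; split=> //; exact: S1body.
have [x S2x x0] := part_off_line card_face c (splitsC hS) hp tt.
exists x; split=> //; first exact: S2body.
move=> S1x; move: x0; have [s ->] := Cl _ (S12 _ S1x S2x).
by rewrite (_ : cross t _ = 0) ?eqxx//; coords; ring.
Qed.

Lemma reglued_same_freedom :
  same_freedom K p A B A' B' S1 S2 h0 (reglue k A B A' B') (@symmetry_of R k).
Proof.
have [sp0|sp0] := eqVneq (spr (fun x => x *m p)) 0.
  split; [exact: twist_motion|by move=> _; exact: twist_collinear|move=> hcut].
  by split; [exact: untwist_motion|move=> _; exact: untwist_collinear].
split; [exact: twist_motion|exact: twist_flexible|move=> hcut].
by split; [exact: untwist_motion|exact: untwist_flexible].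
Qed.

End Reglued.

Theorem theorem3 (R : realType) (n : nat) (K : {set {set 'I_n}}) (p : 'M[R]_(n, 3))
  (A B A' B' : 'rV[R]_n) (S1 S2 : set 'rV[R]_n)
  (hK : triangulated_surface R K) (hp : realization K p)
  (hA : on_edge K A) (hB : on_edge K B) (hA' : on_edge K A') (hB' : on_edge K B')
  (hAB : on_common_face K A B) (hBA' : on_common_face K B A')
  (hA'B' : on_common_face K A' B') (hB'A : on_common_face K B' A)
  (hS : splits K (quadrilateral A B A' B') S1 S2) :
  (forall h : 'rV[R]_3 -> 'rV[R]_3,
     half_turn_symmetry h (A *m p) (B *m p) (A' *m p) (B' *m p) ->
     same_freedom K p A B A' B' S1 S2 h (twist_glued A B A' B') (@half_turn_symmetry R)) /\
  (forall h : 'rV[R]_3 -> 'rV[R]_3,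
     reflection_symmetry h (A *m p) (B *m p) (A' *m p) (B' *m p) ->
     same_freedom K p A B A' B' S1 S2 h (reflect_glued A B A' B') (@reflection_symmetry R)).
Proof.
split=> h hs.
  by apply: (@reglued_same_freedom R n K p A B A' B' S1 S2 true).
by apply: (@reglued_same_freedom R n K p A B A' B' S1 S2 false).
Qed.
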